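(* There exist two countable fields that are isotypic (as structures in the first-order language of rings) but not isomorphic.
   Context: Let $\mathcal L$ be a first-order language and $A$ an $\mathcal L$-structure. For a finite tuple $\bar a=(a_1,\ldots,a_k)$ of elements of $A$, the type $\mathrm{tp}_A(\bar a)$ is the set of all first-order $\mathcal L$-formulas (without parameters) in $k$ free variables that hold in $A$ at $\bar a$. Two $\mathcal L$-structures $A$ and $B$ are isotypic if for every finite tuple $\bar a=(a_1,\ldots,a_k)$ over $A$ there is a tuple $\bar b=(b_1,\ldots,b_k)$ over $B$ of the same length with $\mathrm{tp}_A(\bar a)=\mathrm{tp}_B(\bar b)$, and vice versa (for every finite tuple over $B$ there is a tuple over $A$ of the same length with the same type). *)

(* Defs.v *)
From HB Require Import structures.
From mathcomp Require Import all_boot all_order all_algebra.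
From mathcomp Require Import classical_sets.

Set Implicit Arguments.
Unset Strict Implicit.
Unset Printing Implicit Defensive.

Import GRing.Theory.

(* First-order logic with equality. MathComp's [GRing.formula R] is not used,
   because its terms contain constants for all elements of [R] (parameters). *)

Record language := Language {
  fun_symb : Type;
  fun_arity : fun_symb -> nat;
  rel_symb : Type;
  rel_arity : rel_symb -> nat
}.

Record structure (L : language) := Structure {
  carrier :> Type;
  fun_interp : forall f : fun_symb L, (fun_arity f).-tuple carrier -> carrier;
  rel_interp : forall r : rel_symb L, (rel_arity r).-tuple carrier -> Prop
}.

Inductive term (L : language) (k : nat) : Type :=
| Var of 'I_k
| App (f : fun_symb L) of ('I_(fun_arity f) -> term L k).

(* [formula L k] is the type of formulas whose free variables are among
   [k] variables. Variables are de Bruijn indices: in the scope of a quantifier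
   the bound variable is [ord0], and the free variable [i] becomes [i + 1]. *)
Inductive formula (L : language) : nat -> Type :=
| Equal k of term L k & term L k : formula L k
| Rel k (r : rel_symb L) of ('I_(rel_arity r) -> term L k) : formula L k
| Not k of formula L k : formula L k
| And k of formula L k & formula L k : formula L k
| Or k of formula L k & formula L k : formula L k
| Implies k of formula L k & formula L k : formula L k
| Forall k of formula L k.+1 : formula L k
| Exists k of formula L k.+1 : formula L k.

Fixpoint eval (L : language) (A : structure L) (k : nat) (a : k.-tuple A)
    (t : term L k) : A :=
  match t with
  | Var i => tnth a i
  | App f ts => fun_interp [tuple eval a (ts i) | i < fun_arity f]
  end.

Fixpoint holds (L : language) (A : structure L) (k : nat)
    (phi : formula L k) : k.-tuple A -> Prop :=
  match phi in formula _ k return k.-tuple A -> Prop with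
  | Equal _ t u => fun a => eval a t = eval a u
  | Rel _ r ts => fun a => rel_interp [tuple eval a (ts i) | i < rel_arity r]
  | Not _ p => fun a => ~ holds p a
  | And _ p q => fun a => holds p a /\ holds q a
  | Or _ p q => fun a => holds p a \/ holds q a
  | Implies _ p q => fun a => holds p a -> holds q a
  | Forall _ p => fun a => forall x : A, holds p [tuple of x :: a]
  | Exists _ p => fun a => exists x : A, holds p [tuple of x :: a]
  end.

Definition tp (L : language) (A : structure L) (k : nat) (a : k.-tuple A) :
    set (formula L k) :=
  [set phi | holds phi a]%classic.

Definition isotypic (L : language) (A B : structure L) : Prop :=
  (forall (k : nat) (a : k.-tuple A), exists b : k.-tuple B, tp a = tp b) /\
  (forall (k : nat) (b : k.-tuple B), exists a : k.-tuple A, tp a = tp b).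

Inductive ring_symb := Zero | One | Opp | Add | Mul.

Definition ring_arity (s : ring_symb) : nat :=
  match s with
  | Zero | One => 0
  | Opp => 1
  | Add | Mul => 2
  end.

Definition ring_language : language :=
  Language ring_arity (fun r : void => match r with end).

Definition ring_interp (R : nzRingType) (s : ring_symb) :
    (ring_arity s).-tuple R -> R :=
  match s return (ring_arity s).-tuple R -> R with
  | Zero => fun=> 0%R
  | One => fun=> 1%R
  | Opp => fun v => (- tnth v ord0)%R
  | Add => fun v => (tnth v ord0 + tnth v ord_max)%R
  | Mul => fun v => (tnth v ord0 * tnth v ord_max)%R
  end.

Definition ring_structure (R : nzRingType) : structure ring_language :=
  @Structure ring_language R (@ring_interp R)
    (fun r : void => match r with end).

Definition ring_isomorphic (R S : nzRingType) : Prop :=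
  exists f : {rmorphism R -> S}, bijective f.

(* Main.v *)
Require Import Defs.
From HB Require Import structures.
From mathcomp Require Import all_boot all_order all_algebra.
From mathcomp Require Import finmap generic_quotient ring_quotient.
From mathcomp Require Import boolp classical_sets functions filter.
From mathcomp Require Import polyrcf qe_rcf_th realalg lra.

(** Both fields are real closures inside one real closed field H: the first of
    Q(t_0, t_1, ...), the second of Q(t_0, t_1, ..., w), where t_0 exceeds all
    integers, t_(i+1) exceeds all powers of t_i, and w exceeds all powers of
    every t_i.

    They are isotypic. In real closed fields the type of a tuple is determined
    by the signs of the integer polynomials at that tuple ([same_signs_tp]). If
    each entry of a tuple exceeds everything that integer polynomials produce
    from the smaller entries, then the sign of an integer polynomial at the
    tuple is that of an iterated leading coefficient; hence two such rapid
    tuples of the same length have the same type ([rapid_tp]). An element of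
    either field is algebraic over finitely many generators, which fit into a
    rapid tuple r. Let r' be a rapid tuple of the same length in the other
    field. An algebraic condition has finitely many solutions, so finitely many
    formulas separate the bad candidates from the element, and the type of any
    finite tuple algebraic over r is realized over r' ([tp_extend],
    [tp_algebraic_step], [transfer_tp]).

    They are not isomorphic. An isomorphism preserves the order because the
    nonnegative elements are the squares. The powers of w are cofinal in the
    second field, while in the first field no element has cofinal powers. Both
    facts follow from [tp_algebraic_bounded]: if x is algebraic over a rapid
    tuple r and exceeds all powers of the largest entry of r, then x followed
    by r is rapid again, hence x has the same type over r as t_j over
    t_k, ..., t_0 for every j > k; but the type of an algebraic element has
    finitely many realizations.

    [same_signs_tp] is quantifier elimination without syntax. A quantifier is
    treated by a back-and-forth step: if two tuples have the same signs, every
    element on one side is matched, for finitely many polynomials, by an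
    element on the other side ([transfer_signs]). The reason is that Sturm
    sequences and Tarski queries only use ring operations and sign tests on the
    coefficients. A compactness argument in an ultrapower bounds the set of
    signs that have to be compared ([agree_step]), so that the step can be
    iterated along a formula ([formula_signs]). An ultrapower of the real
    algebraic numbers also serves as H, with t_i the class of 2^(n^(i+1)) and w
    the class of 2^(n^n) ([exists_chain_and_bound]). *)

Set Implicit Arguments.
Unset Strict Implicit.
Unset Printing Implicit Defensive.

Import Order.TTheory GRing.Theory Num.Theory.
Import Pdiv.Ring.

Local Open Scope ring_scope.

Local Notation rterm := (term ring_language).

(** * Renaming variables *)

Lemma tnth_cons0 (T : Type) k (x : T) (a : k.-tuple T) : tnth [tuple of x :: a] ord0 = x.
Proof. by rewrite (tnth_nth x). Qed.

Lemma tnth_consS (T : Type) k (x : T) (a : k.-tuple T) i :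
  tnth [tuple of x :: a] (lift ord0 i) = tnth a i.
Proof. by rewrite !(tnth_nth x). Qed.

Section Rename.
Variable L : language.

Definition subtuple (T : Type) k m (f : 'I_k -> 'I_m) (a : m.-tuple T) : k.-tuple T :=
  [tuple tnth a (f i) | i < k].

Fixpoint rename_term k m (f : 'I_k -> 'I_m) (t : term L k) : term L m :=
  match t with
  | Var i => Var L (f i)
  | App s ts => App (fun i => rename_term f (ts i))
  end.

Definition rename_up k m (f : 'I_k -> 'I_m) (i : 'I_k.+1) : 'I_m.+1 :=
  if unlift ord0 i is Some j then lift ord0 (f j) else ord0.

Fixpoint rename k (phi : formula L k) : forall m, ('I_k -> 'I_m) -> formula L m :=
  match phi in formula _ k return forall m, ('I_k -> 'I_m) -> formula L m with
  | Equal _ t u => fun m f => Equal (rename_term f t) (rename_term f u)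
  | Rel _ r ts => fun m f => Rel (fun i => rename_term f (ts i))
  | Not _ p => fun m f => Not (rename p f)
  | And _ p q => fun m f => And (rename p f) (rename q f)
  | Or _ p q => fun m f => Or (rename p f) (rename q f)
  | Defs.Implies _ p q => fun m f => Defs.Implies (rename p f) (rename q f)
  | Forall _ p => fun m f => Forall (rename p (rename_up f))
  | Exists _ p => fun m f => Exists (rename p (rename_up f))
  end.

Variable A : structure L.

Lemma eval_rename k m (f : 'I_k -> 'I_m) (a : m.-tuple A) t :
  eval a (rename_term f t) = eval (subtuple f a) t.
Proof.
elim: t => [i|s ts IH] /=; first by rewrite tnth_mktuple.
by congr fun_interp; apply: eq_from_tnth => i; rewrite !tnth_mktuple.
Qed.

Lemma subtuple_up k m (f : 'I_k -> 'I_m) (a : m.-tuple A) x :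
  subtuple (rename_up f) [tuple of x :: a] = [tuple of x :: subtuple f a].
Proof.
apply: eq_from_tnth => i; rewrite tnth_mktuple /rename_up.
by case: unliftP => [j|] ->; rewrite ?tnth_cons0 // !tnth_consS tnth_mktuple.
Qed.

Lemma holds_rename k (phi : formula L k) m (f : 'I_k -> 'I_m) (a : m.-tuple A) :
  holds (rename phi f) a <-> holds phi (subtuple f a).
Proof.
elim: phi m f a => {k} [k t u|k r ts|k p IH|k p IHp q IHq|k p IHp q IHq
  |k p IHp q IHq|k p IH|k p IH] m f a /=.
- by rewrite !eval_rename.
- set u := [tuple _ | _ < _]; set v := [tuple _ | _ < _].
  by have -> : u = v by apply: eq_from_tnth => i; rewrite !tnth_mktuple eval_rename.
- by rewrite IH.
- by rewrite IHp IHq.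
- by rewrite IHp IHq.
- by rewrite IHp IHq.
- by split=> h x; have := h x; rewrite IH subtuple_up.
by split=> -[x h]; exists x; move: h; rewrite IH subtuple_up.
Qed.

End Rename.

Section SameType.
Variables (L : language) (A B : structure L).

Lemma tp_eqP k (a : k.-tuple A) (b : k.-tuple B) :
  tp a = tp b <-> forall phi, holds phi a <-> holds phi b.
Proof.
split=> [e phi|h]; last by apply/funext => phi; apply/propext/h.
by rewrite -[holds phi a]/(tp a phi) e.
Qed.

(** Types of long tuples determine types of their rearrangements and parts:
    a formula about the part is a renamed formula about the whole. *)
Lemma tp_subtuple k m (f : 'I_k -> 'I_m) (a : m.-tuple A) (b : m.-tuple B) :
  tp a = tp b -> tp (subtuple f a) = tp (subtuple f b).
Proof.
move/tp_eqP => h; apply/tp_eqP => phi.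
by rewrite -!holds_rename; exact: h.
Qed.

End SameType.

(** * Terms of the language of rings *)

Section RingTerms.

Definition tbin k (s : ring_symb) (t u : rterm k) : rterm k :=
  @App ring_language k s (fun i => if i == 0%N :> nat then t else u).

Definition teval (R : nzRingType) k (a : k.-tuple R) (t : rterm k) : R :=
  @eval ring_language (ring_structure R) k a t.

Variable R : nzRingType.

Definition tzero k : rterm k :=
  @App ring_language k Zero (fun i : 'I_0 => match notF (ltn_ord i) with end).
Definition tone k : rterm k :=
  @App ring_language k One (fun i : 'I_0 => match notF (ltn_ord i) with end).
Definition tvar k (i : 'I_k) : rterm k := Var ring_language i.
Definition tmul k : rterm k -> rterm k -> rterm k := tbin Mul.
Definition tadd k : rterm k -> rterm k -> rterm k := tbin Add.
Definition topp k (t : rterm k) : rterm k := @App ring_language k Opp (fun=> t).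
Definition tsub k (t u : rterm k) : rterm k := tadd t (topp u).

Variables (k : nat) (a : k.-tuple R).

Lemma teval_var i : teval a (tvar i) = tnth a i. Proof. by []. Qed.
Lemma teval_zero : teval a (tzero k) = 0. Proof. by []. Qed.
Lemma teval_one : teval a (tone k) = 1. Proof. by []. Qed.
Lemma teval_opp t : teval a (topp t) = - teval a t.
Proof. by rewrite /teval /= /GRing.opp /= tnth_mktuple. Qed.
Lemma teval_add t u : teval a (tadd t u) = teval a t + teval a u.
Proof. by rewrite /teval /= !tnth_mktuple. Qed.
Lemma teval_mul t u : teval a (tmul t u) = teval a t * teval a u.
Proof. by rewrite /teval /= !tnth_mktuple. Qed.
Lemma teval_sub t u : teval a (tsub t u) = teval a t - teval a u.
Proof. by rewrite teval_add teval_opp. Qed.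

End RingTerms.

(** The arguments of a symbol form a function on ordinals, so a given term is
    only extensionally of the form [tadd u v]; the hypotheses therefore mention
    values, which is all that the properties below depend on. *)
Lemma rterm_ind k (P : term ring_language k -> Prop) :
  (forall i, P (tvar i)) ->
  (forall t, (forall (R : nzRingType) (a : k.-tuple R), teval a t = 0%R) -> P t) ->
  (forall t, (forall (R : nzRingType) (a : k.-tuple R), teval a t = 1%R) -> P t) ->
  (forall t u, (forall (R : nzRingType) (a : k.-tuple R), teval a t = - teval a u)%R ->
     P u -> P t) ->
  (forall t u v, (forall (R : nzRingType) (a : k.-tuple R),
     teval a t = teval a u + teval a v)%R -> P u -> P v -> P t) ->
  (forall t u v, (forall (R : nzRingType) (a : k.-tuple R),
     teval a t = teval a u * teval a v)%R -> P u -> P v -> P t) ->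
  forall t, P t.
Proof.
move=> Pv P0 P1 PN PD PM; elim=> [//|[] ts IH].
- exact: P0.
- exact: P1.
- by apply: (PN _ (ts ord0)) => // R a; rewrite /teval /= tnth_mktuple.
- by apply: (PD _ (ts ord0) (ts ord_max)) => // R a; rewrite /teval /= !tnth_mktuple.
by apply: (PM _ (ts ord0) (ts ord_max)) => // R a; rewrite /teval /= !tnth_mktuple.
Qed.

Lemma teval_rename (R : nzRingType) k m (f : 'I_k -> 'I_m) (a : m.-tuple R) t :
  teval a (rename_term f t) = teval (subtuple f a) t.
Proof. exact: (@eval_rename _ (ring_structure R)). Qed.

(** * Sign conditions over corresponding coefficients *)

(** The graph of an isomorphism between ordered subrings of [K] and [L]. A
    relation avoids forming the subrings as types. *)
Record partial_embedding (K L : rcfType) (E : K -> L -> Prop) : Prop :=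
  PartialEmbedding {
    pemb1 : E 1 1;
    pembB : forall x y x' y', E x x' -> E y y' -> E (x - y) (x' - y');
    pembM : forall x y x' y', E x x' -> E y y' -> E (x * y) (x' * y');
    pemb_sgz : forall x x', E x x' -> sgz x = sgz x'
  }.

(** The coefficients that turn Tarski queries into root counts are rational and
    do not depend on the field. *)
Lemma map_coefs (R S : numFieldType) (f : {rmorphism R -> S}) n i :
  coefs S n i = f (coefs R n i).
Proof.
rewrite /coefs; have [lt_i|le_i] := ltnP i (3 ^ n)%N; last first.
  rewrite nth_default; last by rewrite size_map size_enum_ord.
  by rewrite nth_default ?rmorph0 // size_map size_enum_ord.
have o : 'I_(3 ^ n) by rewrite exp3n; exact: ord0.
rewrite (nth_map o) ?size_enum_ord // [in RHS](nth_map o) ?size_enum_ord //.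
rewrite !castmxE /=.
have -> : map_mx (intmul 1 : int -> S) (ctmat n)
        = map_mx f (map_mx (intmul 1 : int -> R) (ctmat n)).
  by apply/matrixP => a b; rewrite !mxE /= rmorph_int.
by rewrite -map_invmx mxE.
Qed.

Section PartialEmbedding.
Variables (K L : rcfType) (E : K -> L -> Prop).
Hypothesis PE : partial_embedding E.

Let E1 : E 1 1. Proof. exact: pemb1 PE. Qed.
Let EB x y x' y' : E x x' -> E y y' -> E (x - y) (x' - y').
Proof. exact: (pembB PE). Qed.
Let EM x y x' y' : E x x' -> E y y' -> E (x * y) (x' * y').
Proof. exact: (pembM PE). Qed.

Lemma pemb0 : E 0 0.
Proof. by rewrite -(subrr 1) -[X in E _ X](subrr 1); apply: EB. Qed.

Lemma pembN x x' : E x x' -> E (- x) (- x').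
Proof. by rewrite -[- x]sub0r -[- x']sub0r; apply: EB pemb0. Qed.

Lemma pembD x y x' y' : E x x' -> E y y' -> E (x + y) (x' + y').
Proof. by move=> Ex /pembN; rewrite -[y in x + y]opprK -[y' in x' + y']opprK; apply: EB. Qed.

Lemma pembMn n x x' : E x x' -> E (x *+ n) (x' *+ n).
Proof. by move=> Ex; elim: n => [|n IH]; [exact: pemb0 | rewrite !mulrS; exact: pembD]. Qed.

Lemma pembX n x x' : E x x' -> E (x ^+ n) (x' ^+ n).
Proof. by move=> Ex; elim: n => [//|n IH]; rewrite !exprS; exact: EM. Qed.

Lemma pemb_eq0 x x' : E x x' -> (x == 0) = (x' == 0).
Proof. by move=> /(pemb_sgz PE); rewrite -[x == 0]sgz_eq0 => ->; rewrite sgz_eq0. Qed.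

Lemma pemb_gt0 x x' : E x x' -> (0 < x) = (0 < x').
Proof. by move=> /(pemb_sgz PE) e; rewrite -(sgz_gt0 x) -(sgz_gt0 x') e. Qed.

Definition poly_rel (p : {poly K}) (q : {poly L}) := forall i, E p`_i q`_i.

Lemma poly_rel0 : poly_rel 0 0.
Proof. by move=> i; rewrite !coef0; exact: pemb0. Qed.

Lemma poly_relC c d : E c d -> poly_rel c%:P d%:P.
Proof. by move=> Ec i; rewrite !coefC; case: ifP => // _; exact: pemb0. Qed.

Lemma poly_relD p1 p2 q1 q2 : poly_rel p1 q1 -> poly_rel p2 q2 -> poly_rel (p1 + p2) (q1 + q2).
Proof. by move=> h1 h2 i; rewrite !coefD; exact: pembD. Qed.

Lemma poly_relB p1 p2 q1 q2 : poly_rel p1 q1 -> poly_rel p2 q2 -> poly_rel (p1 - p2) (q1 - q2).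
Proof. by move=> h1 h2 i; rewrite !coefB; exact: EB. Qed.

Lemma poly_relN p q : poly_rel p q -> poly_rel (- p) (- q).
Proof. by move=> h i; rewrite !coefN; exact: pembN. Qed.

Lemma poly_relM p1 p2 q1 q2 : poly_rel p1 q1 -> poly_rel p2 q2 -> poly_rel (p1 * p2) (q1 * q2).
Proof.
move=> h1 h2 i; rewrite !coefM.
by apply: (big_rec2 (fun x y => E x y)) => [|j x y _]; [exact: pemb0 | apply/pembD/EM].
Qed.

Lemma poly_relZ c d p q : E c d -> poly_rel p q -> poly_rel (c *: p) (d *: q).
Proof. by move=> Ec h i; rewrite !coefZ; exact: EM. Qed.

Lemma poly_relXn n : poly_rel 'X^n 'X^n.
Proof. by move=> i; rewrite !coefXn; exact: pembMn. Qed.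

Lemma poly_relX : poly_rel 'X 'X.
Proof. by have := poly_relXn 1; rewrite !expr1. Qed.

Lemma poly_rel_exp n p q : poly_rel p q -> poly_rel (p ^+ n) (q ^+ n).
Proof.
by move=> h; elim: n => [|n IH]; rewrite ?expr0 ?exprS; [exact: poly_relC | exact: poly_relM].
Qed.

Lemma poly_rel_deriv p q : poly_rel p q -> poly_rel p^`() q^`().
Proof. by move=> h i; rewrite !coef_deriv; exact: pembMn. Qed.

Lemma poly_rel_prod (I : Type) (r : seq I) (P : pred I) F G :
  (forall i, poly_rel (F i) (G i)) ->
  poly_rel (\prod_(i <- r | P i) F i) (\prod_(i <- r | P i) G i).
Proof.
move=> h; apply: (big_rec2 (fun x y => poly_rel x y)) => [|i x y _]; first exact: poly_relC.
exact: poly_relM.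
Qed.

Lemma poly_rel_size p q : poly_rel p q -> size p = size q.
Proof.
move=> h; apply/eqP; rewrite eqn_leq; apply/andP; split; apply/leq_sizeP => j le_j.
  by apply/eqP; rewrite (pemb_eq0 (h j)); apply/eqP/(leq_sizeP _ _ (leqnn _)).
by apply/eqP; rewrite -(pemb_eq0 (h j)); apply/eqP/(leq_sizeP _ _ (leqnn _)).
Qed.

Lemma poly_rel_eq0 p q : poly_rel p q -> (p == 0) = (q == 0).
Proof. by move=> h; rewrite -!size_poly_eq0 (poly_rel_size h). Qed.

Lemma poly_rel_lead_coef p q : poly_rel p q -> E (lead_coef p) (lead_coef q).
Proof. by move=> h; rewrite /lead_coef (poly_rel_size h). Qed.

(** Pseudo-division multiplies by leading coefficients instead of dividing, so it
    stays within ring operations on corresponding coefficients. *)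
Lemma poly_rel_redivp p1 p2 q1 q2 : poly_rel p1 q1 -> poly_rel p2 q2 ->
  rscalp p1 p2 = rscalp q1 q2 /\ poly_rel (rmodp p1 p2) (rmodp q1 q2).
Proof.
move=> h1 h2; rewrite /rscalp /rmodp !unlock /redivp_expanded_def /redivp_rec.
rewrite (poly_rel_eq0 h2); case: ifP => // _.
rewrite (poly_rel_size h1) (poly_rel_size h2).
move: (size q1) => n; elim: n 0%N (0 : {poly K}) (0 : {poly L}) p1 q1 h1 => [|n IH] k s t r r' h /=.
  rewrite (poly_rel_size h); case: ifP => // _; split=> //=.
  apply: poly_relB; apply: poly_relM => //.
    exact/poly_relC/poly_rel_lead_coef.
  by apply: poly_relZ; [exact: poly_rel_lead_coef | exact: poly_relXn].
rewrite (poly_rel_size h); case: ifP => // _; apply: IH.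
apply: poly_relB; apply: poly_relM => //.
  exact/poly_relC/poly_rel_lead_coef.
by apply: poly_relZ; [exact: poly_rel_lead_coef | exact: poly_relXn].
Qed.

Lemma poly_rel_next_mod p1 p2 q1 q2 : poly_rel p1 q1 -> poly_rel p2 q2 ->
  poly_rel (next_mod p1 p2) (next_mod q1 q2).
Proof.
move=> h1 h2; have [e h] := poly_rel_redivp h1 h2.
rewrite /next_mod e; apply: poly_relZ => //.
exact/pembN/pembX/poly_rel_lead_coef.
Qed.

(** The heads of the two remainder sequences are related as well: the induction
    needs them because a sign change involves two consecutive terms. *)
Lemma changes_mods_rel p1 p2 q1 q2 : poly_rel p1 q1 -> poly_rel p2 q2 ->
  changes_mods p1 p2 = changes_mods q1 q2.
Proof.
move=> h1 h2; rewrite /changes_mods /mods (poly_rel_size h1) (poly_rel_size h2).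
set auxK := fix aux _ _ n := if n is _.+1 then _ else _.
set auxL := fix aux _ _ n := if n is _.+1 then _ else _.
suff: forall n, [/\ changes_minfty (auxK p1 p2 n) = changes_minfty (auxL q1 q2 n),
   changes_pinfty (auxK p1 p2 n) = changes_pinfty (auxL q1 q2 n) &
   poly_rel (head 0 (auxK p1 p2 n)) (head 0 (auxL q1 q2 n))].
  by rewrite /changes_poly => /(_ (maxn (size q1) (size q2).+1)) [-> ->].
move=> n; elim: n p1 p2 q1 q2 h1 h2 => [|n IH] p1 p2 q1 q2 h1 h2.
  by split=> //; exact: poly_rel0.
rewrite /= (poly_rel_eq0 h1); case: ifP => _; first by split=> //; exact: poly_rel0.
have := IH _ _ _ _ h2 (poly_rel_next_mod h1 h2).
case: (auxK _ _ _) => [|u us]; case: (auxL _ _ _) => [|v vs] /= [em ep eh];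
  rewrite /changes_minfty /changes_pinfty /= in em ep *.
- by rewrite !mulr0 !ltxx; split.
- have v0 : v = 0 by apply/eqP; rewrite -(poly_rel_eq0 eh).
  by rewrite -em -ep v0 lead_coef0 !mulr0 !ltxx; split.
- have u0 : u = 0 by apply/eqP; rewrite (poly_rel_eq0 eh).
  by rewrite em ep u0 lead_coef0 !mulr0 !ltxx; split.
have Elt x x' : E x x' -> (x < 0) = (x' < 0).
  by move/(pemb_sgz PE) => e; rewrite -(sgz_lt0 x) -(sgz_lt0 x') e.
have EN1 i : E ((-1) ^+ i) ((-1) ^+ i) by exact/pembX/pembN.
rewrite em ep (poly_rel_size h1) (poly_rel_size eh); split=> //; congr (_ + _)%N; congr nat_of_bool;
  apply: Elt; apply: EM; try apply: EM => //; exact: poly_rel_lead_coef.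
Qed.

Lemma taqR_rel p1 p2 q1 q2 : poly_rel p1 q1 -> poly_rel p2 q2 -> taqR p1 p2 = taqR q1 q2.
Proof. by move=> h1 h2; apply: changes_mods_rel => //; apply/poly_relM/h2/poly_rel_deriv. Qed.

Definition poly_rels (ps : seq {poly K}) (qs : seq {poly L}) :=
  size ps = size qs /\ forall i, poly_rel ps`_i qs`_i.

Lemma poly_rel_poly_comb ps qs sc : poly_rels ps qs -> poly_rel (poly_comb ps sc) (poly_comb qs sc).
Proof.
move=> [e h]; rewrite /poly_comb e; apply: poly_rel_prod => i.
exact: poly_rel_exp.
Qed.

(** Both counts are images of one rational number, computed from integers that
    agree over the two fields. *)
Lemma ccount_weak_rel p q ps qs : poly_rel p q -> poly_rels ps qs ->
  (0 < ccount_weak p ps) = (0 < ccount_weak q qs).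
Proof.
move=> h hs.
suff [c [-> ->]] : exists c : rat, ccount_weak p ps = ratr c /\ ccount_weak q qs = ratr c.
  by rewrite !ltr0q.
rewrite /ccount_weak (proj1 hs); set auxK := fix aux s i := if i is i'.+1 then _ else s.
set auxL := fix aux s i := if i is i'.+1 then _ else s.
suff: forall n s, exists c, auxK (ratr s) n = ratr c /\ auxL (ratr s) n = ratr c.
  by move=> /(_ (3 ^ size qs)%N 0); rewrite !rmorph0.
elim=> [|n IH] s; first by exists s.
have -> : auxK (ratr s) n.+1 = auxK (taqsR p ps n * coefs K (size qs) n + ratr s) n by [].
have -> : auxL (ratr s) n.+1 = auxL (taqsR q qs n * coefs L (size qs) n + ratr s) n by [].
rewrite (map_coefs (@ratr K)) (map_coefs (@ratr L)) /taqsR.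
have -> : taqR p [seq poly_comb ps i | i <- sg_tab (size ps)]`_n
        = taqR q [seq poly_comb qs i | i <- sg_tab (size qs)]`_n.
  apply: taqR_rel => //; rewrite (proj1 hs).
  have [lt_n|le_n] := ltnP n (size (sg_tab (size qs))); last first.
    by rewrite !nth_default ?size_map //; exact: poly_rel0.
  by rewrite !(nth_map [::]) //; exact: poly_rel_poly_comb.
have eR (R : realFieldType) (z : int) (u v : rat) :
    z%:~R * ratr u + ratr v = ratr (z%:~R * u + v) :> R.
  by rewrite rmorphD rmorphM /= ratr_int.
by rewrite !eR; exact: IH.
Qed.

Lemma poly_rels_all ps qs (P : {poly K} -> bool) (Q : {poly L} -> bool) :
  poly_rels ps qs -> (forall p q, poly_rel p q -> P p = Q q) ->
  \big[andb/true]_(p <- ps) P p = \big[andb/true]_(q <- qs) Q q.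
Proof.
move=> [e h] PQ; rewrite (big_nth 0) [RHS](big_nth 0) e.
by apply: eq_bigr => i _; exact: PQ.
Qed.

Lemma poly_rels_prod ps qs : poly_rels ps qs -> poly_rel (\prod_(p <- ps) p) (\prod_(q <- qs) q).
Proof.
by move=> [e h]; rewrite (big_nth 0) [X in poly_rel _ X](big_nth 0) e; exact: poly_rel_prod.
Qed.

(** Whether one equation and some strict inequalities have a common solution is
    decided by the signs of quantities computed from the coefficients by ring
    operations and sign tests; corresponding quantities over [L] have the same
    signs. *)
Lemma solvable_rel p q ps qs : poly_rel p q -> poly_rels ps qs ->
  (exists x, (p.[x] == 0) && \big[andb/true]_(r <- ps) (0 < r.[x])) ->
  (exists y, (q.[y] == 0) && \big[andb/true]_(r <- qs) (0 < r.[y])).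
Proof.
move=> h hs; have [q0 [x /andP[_ pos_x]]|q_neq0] := eqVneq q 0; last first.
  have p_neq0 : p != 0 by rewrite (poly_rel_eq0 h).
  move/(ccount_weakP _ p_neq0); rewrite (ccount_weak_rel h hs).
  exact: (elimT (ccount_weakP _ q_neq0)).
suff /(ccount_gt0P [::] qs) [y /andP[_ pos_y]] : ccount_gt0 [::] qs.
  by exists y; rewrite q0 horner0 eqxx.
have hb : poly_rel (bounding_poly ps) (bounding_poly qs) by exact/poly_rel_deriv/poly_rels_prod.
have : ccount_gt0 [::] ps by apply/ccount_gt0P; exists x; rewrite big_nil.
rewrite /ccount_gt0 !big_nil !eqxx /= (ccount_weak_rel hb hs).
rewrite (poly_rels_all hs (Q := fun r => 0 < lead_coef r)); last first.
  by move=> r s rs; exact/pemb_gt0/poly_rel_lead_coef.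
rewrite (poly_rels_all hs (Q := fun r => 0 < (-1) ^+ (size r).-1 * lead_coef r)) //.
move=> r s rs; rewrite (poly_rel_size rs); apply: pemb_gt0; apply: EM.
  exact/pembX/pembN.
exact: poly_rel_lead_coef.
Qed.

(** The back-and-forth step: an element of [K] is matched in [L] as far as
    finitely many corresponding polynomials can tell. *)
Lemma transfer_signs (ps : seq {poly K}) (qs : seq {poly L}) x : poly_rels ps qs ->
  exists y, forall i, sgz (ps`_i).[x] = sgz (qs`_i).[y].
Proof.
move=> [e h].
(* The vanishing conditions become a single equation, a sum of squares; the
   others become positivity after multiplication by the sign at [x]. *)
pose zs := [seq i <- iota 0 (size qs) | (ps`_i).[x] == 0].
pose ns := [seq i <- iota 0 (size qs) | (ps`_i).[x] != 0].
pose s i := sgz (ps`_i).[x].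
pose p := \sum_(i <- zs) ps`_i ^+ 2; pose q := \sum_(i <- zs) qs`_i ^+ 2.
pose ps' := [seq (s i)%:~R *: ps`_i | i <- ns].
pose qs' := [seq (s i)%:~R *: qs`_i | i <- ns].
have hpq : poly_rel p q.
  apply: (big_rec2 (fun x y => poly_rel x y)) => [|i u v _]; first exact: poly_rel0.
  by apply: poly_relD; exact: poly_rel_exp.
have Es (z : int) : E z%:~R z%:~R.
  by case: z => n; rewrite ?NegzE ?rmorphN -?pmulrn; [|apply: pembN]; exact: pembMn.
have hs' : poly_rels ps' qs'.
  split; rewrite ?size_map // => i.
  have [lt_i|le_i] := ltnP i (size ns); last first.
    by rewrite !nth_default ?size_map //; exact: poly_rel0.
  by rewrite !(nth_map 0%N) //; exact: poly_relZ.
have [|y /andP[/eqP qy]] := solvable_rel hpq hs'.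
  exists x; apply/andP; split.
    rewrite horner_sum big1_seq // => i /andP[_].
    by rewrite mem_filter => /andP[/eqP pi0 _]; rewrite horner_exp pi0 expr0n.
  rewrite big_map big_all; apply/allP => i; rewrite mem_filter => /andP[pi_neq0 _].
  by rewrite hornerZ -sgz_gt0 sgzM sgz_int sgz_id mulz_sg pi_neq0.
rewrite big_map big_all => /allP qs'_gt0.
exists y => i; have [lt_i|le_i] := ltnP i (size qs); last first.
  by rewrite !nth_default ?e // !horner0 !sgz0.
have i_in : i \in iota 0 (size qs) by rewrite mem_iota.
have [pi0|pi_neq0] := eqVneq (ps`_i).[x] 0.
  have : i \in zs by rewrite mem_filter pi0 eqxx.
  move: qy; rewrite horner_sum => /eqP; rewrite psumr_eq0; last first.
    by move=> j _; rewrite horner_exp sqr_ge0.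
  move=> /allP qz /qz /=; rewrite horner_exp sqrf_eq0 => /eqP ->.
  by rewrite pi0 !sgz0.
have /qs'_gt0 : i \in ns by rewrite mem_filter pi_neq0.
rewrite hornerZ -sgz_gt0 sgzM sgz_int sgz_id.
by move: pi_neq0; case: (sgzP (ps`_i).[x]); case: sgzP.
Qed.

End PartialEmbedding.

(** * Ultrapowers of real closed fields *)

Record ultrafilter (I : Type) := MkUltrafilter {
  large :> (I -> Prop) -> Prop;
  large_ultra : UltraFilter (large : set_system I)
}.
#[export] Existing Instance large_ultra.

Section Large.
Variables (I : Type) (U : ultrafilter I).

Lemma largeS (A B : I -> Prop) : (forall i, A i -> B i) -> U A -> U B.
Proof. by move=> AB; apply: filterS. Qed.

Lemma largeI (A B : I -> Prop) : U A -> U B -> U (fun i => A i /\ B i).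
Proof. exact: filterI. Qed.

Lemma largeT (A : I -> Prop) : (forall i, A i) -> U A.
Proof. by move=> AT; apply: largeS filterT. Qed.

Lemma large_ex (A : I -> Prop) : U A -> exists i, A i.
Proof. by move/filter_ex. Qed.

Lemma largeN (A : I -> Prop) : ~ U A -> U (fun i => ~ A i).
Proof. by move=> nA; case: (in_ultra_setVsetC A (large_ultra U)). Qed.

Lemma large_or (A B : I -> Prop) : U (fun i => A i \/ B i) -> U A \/ U B.
Proof.
move=> UAB; case: (pselect (U A)) => [|/largeN nA]; [by left | right].
by apply: largeS (largeI UAB nA) => i [[]].
Qed.

End Large.

Section Ultrapower.
Local Open Scope quotient_scope.
Variables (I : pointedType) (U : ultrafilter I) (R : rcfType).

Definition null_seq : {pred (I -> R)} := fun f => `[< U (fun i => f i = 0) >].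

Lemma null_seqP (f : I -> R) : reflect (U (fun i => f i = 0)) (f \in null_seq).
Proof. exact: asboolP. Qed.

Lemma null_seq_idealr : idealr_closed null_seq.
Proof.
split; first by apply/null_seqP; exact: largeT.
  by apply/negP => /null_seqP /large_ex [i /eqP]; rewrite oner_eq0.
move=> a f g /null_seqP f0 /null_seqP g0; apply/null_seqP.
by apply: largeS (largeI f0 g0) => i [e1 e2]; rewrite /GRing.add /= /GRing.mul /= e1 e2 mulr0 addr0.
Qed.
HB.instance Definition _ := isIdealr.Build _ null_seq null_seq_idealr.

Definition ultrapower : Type := {ideal_quot null_seq}.
HB.instance Definition _ := GRing.ComNzRing.on ultrapower.

Definition cls (f : I -> R) : ultrapower := \pi_({ideal_quot null_seq}) f.
Definition rpr (x : ultrapower) : I -> R := repr (x : {ideal_quot null_seq}).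

Lemma rprK x : cls (rpr x) = x.
Proof. exact: reprK. Qed.

Lemma clsP f g : cls f = cls g <-> U (fun i => f i = g i).
Proof.
split.
  move/eqP; rewrite /cls -Quotient.idealrBE => /null_seqP.
  by apply: largeS => i /eqP; rewrite subr_eq0 => /eqP.
move=> fg; apply/eqP; rewrite /cls -Quotient.idealrBE; apply/null_seqP.
by apply: largeS fg => i fg; rewrite /GRing.add /= /GRing.opp /= fg subrr.
Qed.

Lemma clsD f g : cls f + cls g = cls (fun i => f i + g i).
Proof. by rewrite /cls -rmorphD. Qed.
Lemma clsM f g : cls f * cls g = cls (fun i => f i * g i).
Proof. by rewrite /cls -rmorphM. Qed.
Lemma clsN f : - cls f = cls (fun i => - f i).
Proof. by rewrite /cls -rmorphN. Qed.
Lemma cls0 : 0 = cls (fun=> 0).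
Proof. by rewrite /cls -[LHS](rmorph0 (\pi_{ideal_quot null_seq})). Qed.
Lemma cls1 : 1 = cls (fun=> 1).
Proof. by rewrite /cls -[LHS](rmorph1 (\pi_{ideal_quot null_seq})). Qed.

Lemma rprP f : U (fun i => rpr (cls f) i = f i).
Proof. by apply/clsP; rewrite rprK. Qed.

Definition upow_inv (x : ultrapower) : ultrapower := cls (fun i => (rpr x i)^-1).

Lemma upow_mulVf (x : ultrapower) : x != 0 -> upow_inv x * x = 1.
Proof.
move=> x_neq0; rewrite -[x in _ * x]rprK clsM cls1; apply/clsP.
have : ~ U (fun i => rpr x i = 0).
  by move=> x0; case/eqP: x_neq0; rewrite cls0 -[x]rprK; apply/clsP.
by move/largeN; apply: largeS => i /eqP ?; rewrite mulVf.
Qed.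

Lemma upow_inv0 : upow_inv 0 = 0.
Proof.
rewrite /upow_inv cls0; apply/clsP; apply: largeS (rprP (fun=> 0)) => i ->.
exact: invr0.
Qed.

HB.instance Definition _ := GRing.ComNzRing_isField.Build ultrapower upow_mulVf upow_inv0.

Definition upow_le (x y : ultrapower) := `[< U (fun i => rpr x i <= rpr y i) >].
Definition upow_lt (x y : ultrapower) := (y != x) && upow_le x y.
Definition upow_norm (x : ultrapower) := cls (fun i => `|rpr x i|).

Lemma upow_leP f g : reflect (U (fun i => f i <= g i)) (upow_le (cls f) (cls g)).
Proof.
apply: (iffP (asboolP _)) => h.
  by apply: largeS (largeI h (largeI (rprP f) (rprP g))) => i [h1 [<- <-]].
by apply: largeS (largeI h (largeI (rprP f) (rprP g))) => i [h1 [-> ->]].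
Qed.

Lemma upow_normE f : upow_norm (cls f) = cls (fun i => `|f i|).
Proof. by apply/clsP; apply: largeS (rprP f) => i ->. Qed.

Lemma clsW (P : ultrapower -> Prop) : (forall f, P (cls f)) -> forall x, P x.
Proof. by move=> h x; rewrite -(rprK x). Qed.

Lemma upow_le0_add x y : upow_le 0 x -> upow_le 0 y -> upow_le 0 (x + y).
Proof.
elim/clsW: x => f; elim/clsW: y => g; rewrite clsD cls0 => /upow_leP hf /upow_leP hg.
by apply/upow_leP; apply: largeS (largeI hf hg) => i [*]; exact: addr_ge0.
Qed.
Lemma upow_le0_mul x y : upow_le 0 x -> upow_le 0 y -> upow_le 0 (x * y).
Proof.
elim/clsW: x => f; elim/clsW: y => g; rewrite clsM cls0 => /upow_leP hf /upow_leP hg.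
by apply/upow_leP; apply: largeS (largeI hf hg) => i [*]; exact: mulr_ge0.
Qed.
Lemma upow_le0_anti x : upow_le 0 x -> upow_le x 0 -> x = 0.
Proof.
elim/clsW: x => f; rewrite cls0 => /upow_leP h1 /upow_leP h2; apply/clsP.
by apply: largeS (largeI h1 h2) => i [a b]; apply/eqP; rewrite eq_le a b.
Qed.
Lemma upow_sub_ge0 x y : upow_le 0 (y - x) = upow_le x y.
Proof.
elim/clsW: x => f; elim/clsW: y => g; rewrite clsN clsD cls0.
by apply/upow_leP/upow_leP; apply: largeS => i; rewrite subr_ge0.
Qed.
Lemma upow_le0_total x : upow_le 0 x || upow_le x 0.
Proof.
elim/clsW: x => f; rewrite cls0; apply/orP.
have : U (fun i => 0 <= f i \/ f i <= 0) by apply: largeT => i; exact/orP/le_total.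
by case/large_or => h; [left | right]; apply/upow_leP.
Qed.
Lemma upow_normN x : upow_norm (- x) = upow_norm x.
Proof.
elim/clsW: x => f; rewrite clsN !upow_normE; apply/clsP.
by apply: largeT => i; rewrite normrN.
Qed.
Lemma upow_ge0_norm x : upow_le 0 x -> upow_norm x = x.
Proof.
elim/clsW: x => f; rewrite cls0 upow_normE => /upow_leP h; apply/clsP.
by apply: largeS h => i h; rewrite ger0_norm.
Qed.
Lemma upow_lt_def x y : upow_lt x y = (y != x) && upow_le x y.
Proof. by []. Qed.

HB.instance Definition _ := Num.IntegralDomain_isLeReal.Build ultrapower
  upow_le0_add upow_le0_mul upow_le0_anti upow_sub_ge0 upow_le0_total
  upow_normN upow_ge0_norm upow_lt_def.

Lemma cls_leP f g : reflect (U (fun i => f i <= g i)) (cls f <= cls g).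
Proof. exact: upow_leP. Qed.

Lemma cls_ltP f g : reflect (U (fun i => f i < g i)) (cls f < cls g).
Proof.
rewrite lt_neqAle; apply: (iffP andP) => [[/eqP ne /cls_leP le]|lt].
  have ne' : ~ U (fun i => f i = g i) by move/clsP.
  by apply: largeS (largeI (largeN ne') le) => i [/eqP n l]; rewrite lt_neqAle n.
split; last by apply/cls_leP; apply: largeS lt => i /ltW.
apply/eqP => /clsP fg; have [i []] := large_ex (largeI lt fg).
by move=> + e; rewrite e ltxx.
Qed.

(** The case of the transfer principle for ultrapowers that is needed here:
    signs. *)
Lemma cls_sgz f : U (fun i => sgz (f i) = sgz (cls f)).
Proof.
case: (ltgtP (cls f) 0) => f0.
- rewrite (ltr0_sgz f0); move: f0; rewrite cls0 => /cls_ltP.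
  by apply: largeS => i /ltr0_sgz.
- rewrite (gtr0_sgz f0); move: f0; rewrite cls0 => /cls_ltP.
  by apply: largeS => i /gtr0_sgz.
rewrite f0 sgz0; move: f0; rewrite cls0 => /clsP.
by apply: largeS => i ->; exact: sgz0.
Qed.

(** A polynomial over the ultrapower acts as a family of polynomials over [R];
    this reduces the intermediate value property to that of [R]. *)
Lemma horner_cls (p : {poly ultrapower}) :
  exists q : I -> {poly R}, forall f, p.[cls f] = cls (fun i => (q i).[f i]).
Proof.
elim/poly_ind: p => [|p c [q hq]].
  by exists (fun=> 0) => f; rewrite horner0 cls0; apply/clsP/largeT => i; rewrite horner0.
exists (fun i => q i * 'X + (rpr c i)%:P) => f.
rewrite hornerMXaddC hq clsM -[c]rprK clsD; apply/clsP.
by apply: largeS (rprP (rpr c)) => i e; rewrite hornerMXaddC e.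
Qed.

Lemma upow_ivt : Num.real_closed_axiom ultrapower.
Proof.
move=> p a b; have [q hq] := horner_cls p.
rewrite -[a]rprK -[b]rprK; set f := rpr a; set g := rpr b.
move=> /cls_leP le_fg /andP[]; rewrite !hq cls0 => /cls_leP le_f0 /cls_leP le_0g.
have /choice [h hP] : forall i, exists z,
    [/\ f i <= g i, (q i).[f i] <= 0 & 0 <= (q i).[g i]] ->
    f i <= z <= g i /\ (q i).[z] = 0.
  move=> i; case: (pselect [/\ f i <= g i, (q i).[f i] <= 0 & 0 <= (q i).[g i]]).
    case=> le lef leg; have [//|z z_in /eqP z0] := @poly_ivt _ (q i) (f i) (g i) le.
      by rewrite lef leg.
    by exists z.
  by move=> no; exists 0.
have Uh := largeI le_fg (largeI le_f0 le_0g).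
have {}Uh : U (fun i => f i <= h i <= g i /\ (q i).[h i] = 0).
  by apply: largeS Uh => i [? [? ?]]; exact: hP.
exists (cls h); last first.
  by rewrite /root hq cls0; apply/eqP/clsP; apply: largeS Uh => i [].
by apply/andP; split; apply/cls_leP; apply: largeS Uh => i [/andP[]].
Qed.

HB.instance Definition _ := Num.RealField_isClosed.Build ultrapower upow_ivt.

End Ultrapower.

(** * Signs of terms determine types *)

Section Signs.
Variables (K L : rcfType) (k : nat) (a : k.-tuple K) (b : k.-tuple L).

Definition same_signs := forall u : rterm k, sgz (teval a u) = sgz (teval b u).

(** The correspondence between the subrings generated by [a] and by [b]. *)
Definition covalued (x : K) (y : L) := exists u : rterm k, x = teval a u /\ y = teval b u.

Hypothesis ss : same_signs.

Lemma covalued_partial_embedding : partial_embedding covalued.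
Proof.
split.
- by exists (tone k); rewrite !teval_one.
- by move=> _ _ _ _ [u [-> ->]] [v [-> ->]]; exists (tsub u v); rewrite !teval_sub.
- by move=> _ _ _ _ [u [-> ->]] [v [-> ->]]; exists (tmul u v); rewrite !teval_mul.
by move=> _ _ [u [-> ->]].
Qed.

(** A term in one more variable is a polynomial in that variable, with
    corresponding coefficients over the two tuples. *)
Lemma teval_poly (u : rterm k.+1) : exists (p : {poly K}) (q : {poly L}),
  [/\ poly_rel covalued p q, forall x, teval [tuple of x :: a] u = p.[x] &
      forall y, teval [tuple of y :: b] u = q.[y]].
Proof.
have PE := covalued_partial_embedding.
elim/rterm_ind: u => [i|t e|t e|t u e|t u v e|t u v e].
- have [j ->|->] := unliftP ord0 i; last first.
    by exists 'X, 'X; split=> [|x|y]; [exact: poly_relX | |]; rewrite teval_var tnth_cons0 hornerX.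
  exists (tnth a j)%:P, (tnth b j)%:P.
  split=> [|x|y]; [|by rewrite teval_var tnth_consS hornerC..].
  by apply: poly_relC => //; exists (tvar j).
- by exists 0, 0; split=> [|x|y]; [exact: poly_rel0|rewrite e horner0..].
- exists 1%:P, 1%:P; split=> [|x|y]; [|by rewrite e hornerC..].
  by apply: poly_relC => //; exact: pemb1 PE.
- case=> p [q [h hp hq]]; exists (- p), (- q).
  by split=> [|x|y]; [exact: poly_relN | rewrite e ?hp ?hq hornerN..].
- case=> p [q [h hp hq]] [p' [q' [h' hp' hq']]]; exists (p + p'), (q + q').
  by split=> [|x|y]; [exact: poly_relD | rewrite e ?hp ?hq ?hp' ?hq' hornerD..].
case=> p [q [h hp hq]] [p' [q' [h' hp' hq']]]; exists (p * p'), (q * q').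
by split=> [|x|y]; [exact: poly_relM | rewrite e ?hp ?hq ?hp' ?hq' hornerM..].
Qed.

Lemma same_signs_extend (us : seq (rterm k.+1)) x : exists y,
  forall i, sgz (teval [tuple of x :: a] (nth (tzero _) us i))
          = sgz (teval [tuple of y :: b] (nth (tzero _) us i)).
Proof.
have PE := covalued_partial_embedding.
have /choice [f fP] : forall u, exists pq : {poly K} * {poly L},
    [/\ poly_rel covalued pq.1 pq.2, forall x, teval [tuple of x :: a] u = pq.1.[x] &
      forall y, teval [tuple of y :: b] u = pq.2.[y]].
  by move=> u; have [p [q h]] := teval_poly u; exists (p, q).
have [|y hy] := @transfer_signs _ _ _ PE [seq (f u).1 | u <- us] [seq (f u).2 | u <- us] x.
  split=> [|i]; rewrite ?size_map //.
  have [lt_i|le_i] := ltnP i (size us); last first.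
    by rewrite !nth_default ?size_map //; exact: poly_rel0.
  by rewrite !(nth_map (tzero _)) //; case: (fP (nth (tzero _) us i)).
exists y => i; have [lt_i|le_i] := ltnP i (size us); last first.
  by rewrite !nth_default // !teval_zero !sgz0.
have := hy i; rewrite !(nth_map (tzero _)) //.
by case: (fP (nth (tzero _) us i)) => _ -> ->.
Qed.

End Signs.

Section FilterBase.
Variable T : Type.

(** The index set for compactness: a property that holds for all large enough
    finite sets holds on a large set of indices. *)
Lemma cone_ultrafilter : exists U : ultrafilter {fset {classic T}},
  forall S0 : {fset {classic T}}, U (fun S => (S0 `<=` S)%fset).
Proof.
pose F (A : set {fset {classic T}}) := exists S0 : {fset {classic T}},
  forall S, (S0 `<=` S)%fset -> A S.
have PF : ProperFilter F.
  split; first by move=> [S0 /(_ S0 (fsubset_refl _))].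
  split; first by exists fset0%fset.
    move=> A B [S1 h1] [S2 h2]; exists (S1 `|` S2)%fset => S.
    by rewrite fsubUset => /andP[s1 s2]; split; [exact: h1 | exact: h2].
  by move=> A B AB [S0 h]; exists S0 => S /h /AB.
have [G [UG FG]] := ultraFilterLemma PF.
exists (MkUltrafilter UG) => S0; apply: FG.
by exists S0.
Qed.
End FilterBase.

Section TermsInUltrapower.
Variables (I : pointedType) (U : ultrafilter I) (R : rcfType) (k : nat).

Definition cls_tuple (A : I -> k.-tuple R) : k.-tuple (ultrapower U R) :=
  [tuple cls U (fun i => tnth (A i) j) | j < k].

Lemma teval_cls (A : I -> k.-tuple R) u :
  teval (cls_tuple A) u = cls U (fun i => teval (A i) u).
Proof.
elim/rterm_ind: u => [j|t e|t e|t u e IH|t u v e IHu IHv|t u v e IHu IHv].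
- by rewrite teval_var tnth_mktuple.
- by rewrite e cls0; apply/clsP/largeT => i; rewrite e.
- by rewrite e cls1; apply/clsP/largeT => i; rewrite e.
- by rewrite e IH clsN; apply/clsP/largeT => i; rewrite e.
- by rewrite e IHu IHv clsD; apply/clsP/largeT => i; rewrite e.
by rewrite e IHu IHv clsM; apply/clsP/largeT => i; rewrite e.
Qed.

Lemma sgz_teval_cls (A : I -> k.-tuple R) u :
  U (fun i => sgz (teval (A i) u) = sgz (teval (cls_tuple A) u)).
Proof. by rewrite teval_cls; exact: cls_sgz. Qed.

End TermsInUltrapower.

Lemma cls_tuple_cons (I : pointedType) (U : ultrafilter I) (R : rcfType) k
    (f : I -> R) (A : I -> k.-tuple R) :
  [tuple of cls U f :: cls_tuple U A] = cls_tuple U (fun i => [tuple of f i :: A i]).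
Proof.
apply: eq_from_tnth => i; rewrite [in RHS]tnth_mktuple; have [j ->|->] := unliftP ord0 i.
  rewrite tnth_consS tnth_mktuple; apply/clsP/largeT => l.
  by rewrite tnth_consS.
by rewrite tnth_cons0; apply/clsP/largeT => l; rewrite tnth_cons0.
Qed.

Section Step.
Variables (K L : rcfType).

Definition agree k (S : {fset {classic rterm k}}) (a : k.-tuple K) (b : k.-tuple L) :=
  forall u : rterm k, (u : {classic rterm k}) \in S -> sgz (teval a u) = sgz (teval b u).

(** If no finite set [S] of signs sufficed, choose a counterexample for each [S]
    and pass to the ultrapowers of [K] and [L] along finite sets of terms. The
    tuples there agree on all signs, so [same_signs_extend] matches the
    elements, and reading the signs back on a large set of indices refutes one
    of the counterexamples. *)
Lemma agree_step k (us : seq (rterm k.+1)) : exists S : {fset {classic rterm k}},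
  forall a b, agree S a b -> forall x, exists y,
  forall i, sgz (teval [tuple of x :: a] (nth (tzero _) us i))
          = sgz (teval [tuple of y :: b] (nth (tzero _) us i)).
Proof.
apply: contrapT => /forallNP noS.
have /choice [f fP] : forall S : {fset {classic rterm k}}, exists abx : k.-tuple K * k.-tuple L * K,
   agree S abx.1.1 abx.1.2 /\ ~ (exists y,
  forall i, sgz (teval [tuple of abx.2 :: abx.1.1] (nth (tzero _) us i))
          = sgz (teval [tuple of y :: abx.1.2] (nth (tzero _) us i))).
  move=> S; have /existsNP [a /existsNP [b /not_implyP [ab /existsNP [x hx]]]] := noS S.
  by exists (a, b, x).
have [U coneU] := cone_ultrafilter (rterm k).
pose a S := (f S).1.1; pose b S := (f S).1.2; pose x S := (f S).2.
have ss : same_signs (cls_tuple U a) (cls_tuple U b).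
  move=> u; have Uu : U (fun S => (u : {classic rterm k}) \in S).
    by apply: largeS (coneU [fset (u : {classic rterm k})]%fset) => S; rewrite fsub1set.
  have [S [uS [<- <-]]] :=
    large_ex (largeI Uu (largeI (sgz_teval_cls U a u) (sgz_teval_cls U b u))).
  exact: (fP S).1.
have [y hy] := same_signs_extend ss us (cls U x).
rewrite cls_tuple_cons in hy.
move: hy; rewrite -(rprK y) cls_tuple_cons; set z := rpr y => hy.
have Uall : U (fun S => forall i, (i < size us)%N ->
     sgz (teval [tuple of x S :: a S] (nth (tzero _) us i))
   = sgz (teval [tuple of z S :: b S] (nth (tzero _) us i))).
  elim: (size us) => [|n IH]; first exact: largeT.
  apply: largeS (largeI IH (largeI
    (sgz_teval_cls U (fun S => [tuple of x S :: a S]) (nth (tzero _) us n))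
    (sgz_teval_cls U (fun S => [tuple of z S :: b S]) (nth (tzero _) us n)))).
  move=> S [hS [e1 e2]] i; rewrite ltnS leq_eqVlt => /orP[/eqP ->|/hS //].
  by rewrite e1 e2 hy.
have [S hS] := large_ex Uall.
case: (fP S) => _ []; exists (z S) => i.
have [lt_i|le_i] := ltnP i (size us); first exact: hS.
by rewrite !nth_default // !teval_zero !sgz0.
Qed.

End Step.

(** Quantifier elimination in semantic form. The finite set is what makes the
    induction work: agreement on all signs would not survive a quantifier, since
    a single element of [L] need not match [x] for all terms at once. *)
Lemma formula_signs (K L : rcfType) k (phi : formula ring_language k) :
  exists S : {fset {classic rterm k}}, forall (a : k.-tuple K) (b : k.-tuple L),
  agree S a b -> (@holds _ (ring_structure K) _ phi a <-> @holds _ (ring_structure L) _ phi b).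
Proof.
have agreeI k' (S1 S2 : {fset {classic rterm k'}}) (a : k'.-tuple K) (b : k'.-tuple L) :
    agree (S1 `|` S2)%fset a b -> agree S1 a b /\ agree S2 a b.
  by move=> h; split=> u uS; apply: h; rewrite in_fsetU uS ?orbT.
have step k' (S : {fset {classic rterm k'.+1}}) : exists S' : {fset {classic rterm k'}},
    forall (a : k'.-tuple K) (b : k'.-tuple L), agree S' a b ->
    (forall x, exists y, agree S [tuple of x :: a] [tuple of y :: b]) /\
    (forall y, exists x, agree S [tuple of x :: a] [tuple of y :: b]).
  have [S1 h1] := @agree_step K L k' (enum_fset S).
  have [S2 h2] := @agree_step L K k' (enum_fset S).
  exists (S1 `|` S2)%fset => a b /agreeI [ab1 ab2]; split=> [x|y].
    have [y hy] := h1 a b ab1 x; exists y => u uS.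
    have := hy (index (u : {classic rterm k'.+1}) (enum_fset S)).
    by rewrite (nth_index (tzero k'.+1 : {classic rterm k'.+1}) uS : nth (tzero k'.+1) S _ = u).
  have [|x hx] := h2 b a _ y; first by move=> u uS; rewrite ab2.
  exists x => u uS; have := hx (index (u : {classic rterm k'.+1}) (enum_fset S)).
  by rewrite (nth_index (tzero k'.+1 : {classic rterm k'.+1}) uS : nth (tzero k'.+1) S _ = u).
elim: phi => {k} [k t u|k r ts|k p [S IH]|k p [S IHp] q [S' IHq]|k p [S IHp] q [S' IHq]
  |k p [S IHp] q [S' IHq]|k p [S IH]|k p [S IH]].
- exists [fset (tsub t u : {classic rterm k})]%fset => a b /(_ (tsub t u)).
  rewrite inE eqxx => /(_ isT); rewrite !teval_sub => e.
  suff : (teval a t == teval a u) = (teval b t == teval b u).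
    by move=> {}e; split=> /eqP; [rewrite [_ == _]e | rewrite -[_ == _]e] => /eqP.
  by rewrite -subr_eq0 -sgz_eq0 e sgz_eq0 subr_eq0.
- by case: r ts.
- by exists S => a b /IH /= ->; exact: iff_refl.
- by exists (S `|` S')%fset => a b /agreeI [/IHp /= -> /IHq /= ->]; exact: iff_refl.
- by exists (S `|` S')%fset => a b /agreeI [/IHp /= -> /IHq /= ->]; exact: iff_refl.
- by exists (S `|` S')%fset => a b /agreeI [/IHp /= -> /IHq /= ->]; exact: iff_refl.
- have [S' hS'] := step _ S; exists S' => a b /hS' [xy yx] /=; split=> h z.
    by have [x /IH <-] := yx z; exact: h.
  by have [y /IH ->] := xy z; exact: h.
have [S' hS'] := step _ S; exists S' => a b /hS' [xy yx] /=; split=> -[z hz].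
  by have [y hy] := xy z; exists y; apply/(IH _ _ hy).
by have [x hx] := yx z; exists x; apply/(IH _ _ hx).
Qed.

Lemma same_signs_tp (K L : rcfType) k (a : k.-tuple K) (b : k.-tuple L) :
  same_signs a b ->
  @tp _ (ring_structure K) _ a = @tp _ (ring_structure L) _ b.
Proof.
move=> ss; apply/tp_eqP => phi; have [S hS] := formula_signs K L phi.
by apply: hS => u _; exact: ss.
Qed.

(** * Rapidly decreasing tuples *)

(** The subring generated by [a] has no elements strictly between 0 and 1. This
    keeps leading coefficients away from 0, so that exceeding the elements of
    the subring, rather than their quotients, suffices in [poly_rel_above]. *)
Definition separated (K : rcfType) k (a : k.-tuple K) :=
  forall u : rterm k, teval a u = 0 \/ 1 <= `|teval a u|.

Definition above (K : rcfType) k (a : k.-tuple K) (x : K) := forall u : rterm k, teval a u < x.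

Lemma abs_lt_above (R : rcfType) k (c : k.-tuple R) z : above c z ->
  forall u, `|teval c u| + 1 < z.
Proof.
move=> cz u; have := cz (tadd u (tone k)); have := cz (tadd (topp u) (tone k)).
rewrite !teval_add teval_opp !teval_one.
by case: (ger0P (teval c u)).
Qed.

(** The leading term wins: one step of the Horner scheme at a large [z]. *)
Lemma horner_separated (R : rcfType) (c d z : R) :
  1 <= `|d| -> `|c| + 1 < z -> sgz (d * z + c) = sgz d /\ 1 <= `|d * z + c|.
Proof.
move=> d1 cz; have z0 : 1 < z by apply: le_lt_trans cz; rewrite lerDr.
have [c1 c2] : - z < c - 1 /\ c + 1 < z.
  by move: cz; case: (ger0P c) => *; split; lra.
case: (ltrgt0P d) d1 => [d0|d0|->] d1; last by move: d1; rewrite ?normr0 ler10.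
  have dz : z <= d * z by rewrite ler_peMl //; lra.
  have p0 : 1 <= d * z + c by lra.
  have p1 : 0 < d * z + c by lra.
  by rewrite (gtr0_sgz p1) (gtr0_sgz d0) gtr0_norm.
have dz : z <= - d * z by rewrite ler_peMl //; lra.
have p0 : d * z + c <= -1 by lra.
have p1 : d * z + c < 0 by lra.
by rewrite (ltr0_sgz p1) (ltr0_sgz d0) ltr0_norm //; split=> //; lra.
Qed.

Section RapidExtension.
Variables (K L : rcfType) (k : nat) (a : k.-tuple K) (b : k.-tuple L).
Hypotheses (ss : same_signs a b) (sa : separated a) (sb : separated b).
Variables (x : K) (y : L).
Hypotheses (xa : above a x) (yb : above b y).

(** By induction on the Horner scheme, the sign of a polynomial at a large point
    is the sign of its leading coefficient. *)
Lemma poly_rel_above p q : poly_rel (covalued a b) p q ->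
  (p.[x] = 0 /\ q.[y] = 0) \/
  [/\ sgz p.[x] = sgz q.[y], 1 <= `|p.[x]| & 1 <= `|q.[y]|].
Proof.
elim/poly_ind: p q => [|p c IH] q h.
  have -> : q = 0.
    by apply/eqP; rewrite -(poly_rel_eq0 (covalued_partial_embedding ss) h).
  by left; rewrite !horner0.
pose q' := drop_poly 1 q.
have qE : q = q' * 'X + (q`_0)%:P.
  apply/polyP => i; rewrite coefD coefMX coefC.
  by case: i => [|i] //=; rewrite ?add0r // addr0 coef_drop_poly addn1.
have [u [cE dE]] := h 0.
rewrite coefD coefMX coefC add0r in cE.
have hpq' : poly_rel (covalued a b) p q'.
  move=> i; have := h i.+1; rewrite coefD coefMX coefC addr0 /=.
  by rewrite coef_drop_poly addn1.
rewrite qE !hornerMXaddC; case: (IH _ hpq') => [[-> ->]|[e p1 q1]].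
  rewrite !mul0r !add0r cE dE; have := ss u; case: (sa u) => [-> /esym/eqP|a1 e].
    by rewrite sgz0 sgz_eq0 => /eqP ->; left.
  right; split=> //; case: (sb u) => // b0; move/eqP: e; rewrite b0 sgz0 sgz_eq0 => /eqP a0.
  by rewrite a0 normr0 ler10 in a1.
right; rewrite cE dE.
have [-> ?] := horner_separated p1 (abs_lt_above xa u).
by have [-> ?] := horner_separated q1 (abs_lt_above yb u).
Qed.

Lemma above_extend :
  [/\ same_signs [tuple of x :: a] [tuple of y :: b], separated [tuple of x :: a]
    & separated [tuple of y :: b]].
Proof.
suff h u : (teval [tuple of x :: a] u = 0 /\ teval [tuple of y :: b] u = 0) \/
  [/\ sgz (teval [tuple of x :: a] u) = sgz (teval [tuple of y :: b] u),
      1 <= `|teval [tuple of x :: a] u| & 1 <= `|teval [tuple of y :: b] u|].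
  split=> u; case: (h u) => [[h1 h2]|[h1 h2 h3]]; rewrite ?h1 ?h2 ?sgz0 //; by [left|right].
have [p [q [hpq -> ->]]] := teval_poly ss u.
exact: poly_rel_above.
Qed.

End RapidExtension.

Lemma teval_nil (u : rterm 0) : exists z : int,
  forall (R : nzRingType) (a : 0.-tuple R), teval a u = z%:~R.
Proof.
elim/rterm_ind: u => [[]//|t e|t e|t u e [z IH]|t u v e [z IHu] [z' IHv]|t u v e [z IHu] [z' IHv]].
- by exists 0 => R a; rewrite e.
- by exists 1 => R a; rewrite e.
- by exists (- z) => R a; rewrite e IH rmorphN.
- by exists (z + z') => R a; rewrite e IHu IHv rmorphD.
by exists (z * z') => R a; rewrite e IHu IHv rmorphM.
Qed.

(** Entries are listed in decreasing order, so that the new variable of an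
    extension is the head. *)
Fixpoint rapid (K : rcfType) k : k.-tuple K -> Prop :=
  if k is k'.+1 then
    fun a => rapid (behead_tuple a : k'.-tuple K) /\ above (behead_tuple a : k'.-tuple K) (thead a)
  else fun=> True.

Lemma rapid_consE (K : rcfType) k (a : k.-tuple K) x :
  rapid [tuple of x :: a] <-> rapid a /\ above a x.
Proof.
have e : behead_tuple [tuple of x :: a] = a by exact: val_inj.
have t : thead [tuple of x :: a] = x := tnth_cons0 x a.
by rewrite /rapid -/rapid e t.
Qed.

Lemma rapid_agree (K L : rcfType) k (a : k.-tuple K) (b : k.-tuple L) :
  rapid a -> rapid b -> [/\ same_signs a b, separated a & separated b].
Proof.
elim: k a b => [|k IH] a b.
  move=> _ _; split=> u; have [z hz] := teval_nil u; rewrite !hz ?sgz_int //.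
    have [->|z_neq0] := eqVneq z 0; [by left | right].
    by rewrite -intr_norm ler1z -gtz0_ge1 normr_gt0.
  have [->|z_neq0] := eqVneq z 0; [by left | right].
  by rewrite -intr_norm ler1z -gtz0_ge1 normr_gt0.
case/tupleP: a => x a; case/tupleP: b => y b.
move=> /rapid_consE [ra xa] /rapid_consE [rb yb].
have [ss sa sb] := IH _ _ ra rb.
exact: above_extend.
Qed.

Lemma rapid_tp (K L : rcfType) k (a : k.-tuple K) (b : k.-tuple L) :
  rapid a -> rapid b -> @tp _ (ring_structure K) _ a = @tp _ (ring_structure L) _ b.
Proof. by move=> ra rb; apply: same_signs_tp; case: (rapid_agree ra rb). Qed.

Lemma teval_bound (K : rcfType) (M : K) k (u : rterm k) : 2 <= M -> exists n : nat,
  forall a : k.-tuple K, (forall i, `|tnth a i| <= M) -> `|teval a u| <= M ^+ n.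
Proof.
move=> M2; have M1 : 1 <= M by lra.
have M0 : 0 <= M by lra.
elim/rterm_ind: u => [i|t e|t e|t u e [n IH]|t u v e [n IHu] [m IHv]|t u v e [n IHu] [m IHv]].
- by exists 1%N => a ha; rewrite expr1; exact: ha.
- by exists 0%N => a ha; rewrite e normr0 ler01.
- by exists 0%N => a ha; rewrite e normr1.
- by exists n => a ha; rewrite e normrN IH.
- exists (n + m).+1 => a ha; rewrite e; apply: le_trans (ler_normD _ _) _.
  have Mn := exprn_ege1 n M1; have Mm := exprn_ege1 m M1.
  apply: (@le_trans _ _ (M ^+ n + M ^+ m)); first by apply: lerD; auto.
  rewrite exprS exprD; apply: (@le_trans _ _ (2 * (M ^+ n * M ^+ m))); last first.
    by apply: ler_wpM2r => //; rewrite mulr_ge0 // exprn_ge0.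
  have : M ^+ n <= M ^+ n * M ^+ m by rewrite ler_peMr //; lra.
  have : M ^+ m <= M ^+ n * M ^+ m by rewrite ler_peMl //; lra.
  lra.
by exists (n + m)%N => a ha; rewrite e normrM exprD ler_pM //; auto.
Qed.

Lemma above_pow (K : rcfType) (M : K) k (a : k.-tuple K) x : 2 <= M ->
  (forall i, `|tnth a i| <= M) -> (forall n, M ^+ n < x) -> above a x.
Proof.
move=> M2 aM Mx u; have [n hn] := teval_bound u M2.
by apply: le_lt_trans (Mx n); apply: le_trans (ler_norm _) _; exact: hn.
Qed.

(** * Types of algebraic elements *)

(** If only finitely many [y] satisfy [psi] over [b], one of them has the type of
    [x]: otherwise each candidate violates some formula true of [x], and the
    conjunction of these formulas with [psi] holds for no [y], contradicting
    that [a] and [b] have the same type. *)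
Lemma tp_extend (L : language) (A B : structure L) k (a : k.-tuple A) (b : k.-tuple B)
    (psi : formula L k.+1) (x : A) (cand : seq B) :
  tp a = tp b -> holds psi [tuple of x :: a] ->
  (forall y, holds psi [tuple of y :: b] -> List.In y cand) ->
  exists y, tp [tuple of x :: a] = tp [tuple of y :: b].
Proof.
move=> /tp_eqP ab psix cand_psi; apply: contrapT => /forallNP no_y.
have [phi [phix phiN]] : exists phi : formula L k.+1, holds phi [tuple of x :: a] /\
    forall y, List.In y cand -> ~ holds phi [tuple of y :: b].
  elim: cand {cand_psi} => [|y cand [phi [phix phiN]]].
    by exists psi.
  have [chi [chix chiN]] : exists chi : formula L k.+1,
      holds chi [tuple of x :: a] /\ ~ holds chi [tuple of y :: b].
    apply: contrapT => /forallNP no_chi; apply: (no_y y); apply/tp_eqP => chi.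
    have hN (c : formula L k.+1) : holds c [tuple of x :: a] -> holds c [tuple of y :: b].
      by move=> cx; apply: contrapT => cy; exact: (no_chi c).
    by split=> [/hN //|cy]; apply: contrapT => cx; exact: (hN (Not chi)).
  exists (And phi chi); split=> [//|z [<-|zin]] [hphi hchi]; [exact: chiN | exact: (phiN z)].
have /ab [y [psiy phiy]] : holds (Exists (And psi phi)) a by exists x.
exact: phiN (cand_psi y psiy) phiy.
Qed.

Lemma nth_remove (V : nmodType) (s1 s2 s3 : seq V) :
  [seq (s1 ++ s2 ++ s3)`_i | i <- iota 0 (size s1) ++ iota (size s1 + size s2) (size s3)]
  = s1 ++ s3.
Proof.
rewrite map_cat map_nth_iota0 ?size_cat ?leq_addr // take_size_cat //.
rewrite catA -size_cat map_nth_iota; last by rewrite !size_cat addKn.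
by rewrite drop_size_cat // take_size.
Qed.

(** Reading off a prefix of [s] lets one term be evaluated at ever longer
    sequences. *)
Definition value (R : nzRingType) (s : seq R) n (u : rterm n) : R :=
  teval [tuple s`_i | i < n] u.

Lemma value_tuple (R : nzRingType) k (a : k.-tuple R) n (le_nk : (n <= k)%N) (u : rterm n) :
  value a u = teval a (rename_term (widen_ord le_nk) u).
Proof.
rewrite teval_rename; congr teval; apply: eq_from_tnth => i.
by rewrite !tnth_mktuple (tnth_nth 0).
Qed.

Lemma value_cons0 (R : nzRingType) n (x : R) s : value (x :: s) (tvar (@ord0 n)) = x.
Proof. by rewrite /value teval_var tnth_mktuple. Qed.

Lemma value_consS (R : nzRingType) n (x : R) s (i : 'I_n) :
  value (x :: s) (tvar (lift ord0 i)) = s`_i.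
Proof. by rewrite /value teval_var tnth_mktuple. Qed.

Section SameTp.
Variables (K L : rcfType).
Notation KS := (ring_structure K).
Notation LS := (ring_structure L).

(** Equality of types for sequences, so that tuples can be concatenated and
    rearranged without transporting along equations between their lengths. *)
Definition same_tp (s : seq K) (t : seq L) : Prop :=
  exists k (a : k.-tuple K) (b : k.-tuple L), [/\ s = a, t = b & @tp _ KS _ a = @tp _ LS _ b].

Lemma same_tp_tuple k (a : k.-tuple K) (b : k.-tuple L) :
  same_tp a b <-> @tp _ KS _ a = @tp _ LS _ b.
Proof.
split=> [[k' [a' [b' [ea eb]]]]|]; last by exists k, a, b.
have ek : k = k' by rewrite -(size_tuple a) ea size_tuple.
case: k' / ek a' b' ea eb => a' b' ea eb.
have ea' : a = a' by exact: val_inj.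
have eb' : b = b' by exact: val_inj.
by rewrite ea' eb'.
Qed.

Lemma same_tp_size s t : same_tp s t -> size s = size t.
Proof. by case=> k [a [b [-> -> _]]]; rewrite !size_tuple. Qed.

Lemma same_tp_map s t (js : seq nat) : same_tp s t -> all (fun j => j < size s)%N js ->
  same_tp [seq s`_j | j <- js] [seq t`_j | j <- js].
Proof.
case=> k [a [b [-> -> ab]]]; rewrite size_tuple => js_k.
have k_gt0 (i : 'I_(size js)) : (nth 0 js i < k)%N by have /allP := js_k; apply; exact: mem_nth.
pose f i := Ordinal (k_gt0 i).
exists (size js), (subtuple f a), (subtuple f b); split; last exact: tp_subtuple.
  apply: (@eq_from_nth _ 0) => [|i]; rewrite size_map ?size_tuple // => lt_i.
  by rewrite (nth_map 0%N) // -(tnth_nth 0 _ (Ordinal lt_i)) tnth_mktuple (tnth_nth 0).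
apply: (@eq_from_nth _ 0) => [|i]; rewrite size_map ?size_tuple // => lt_i.
by rewrite (nth_map 0%N) // -(tnth_nth 0 _ (Ordinal lt_i)) tnth_mktuple (tnth_nth 0).
Qed.

Lemma same_tp_drop s1 s2 t1 t2 : size s1 = size t1 ->
  same_tp (s1 ++ s2) (t1 ++ t2) -> same_tp s2 t2.
Proof.
move=> e h; have := same_tp_map (js := iota (size s1) (size s2)) h.
have /eqP := same_tp_size h; rewrite !size_cat e eqn_add2l => /eqP e2.
rewrite !map_nth_iota ?size_cat ?e ?addKn // ?e2 // -{1 2}e !drop_size_cat // take_size -e2 take_size.
by apply; apply/allP => i; rewrite mem_iota -?e => /andP[].
Qed.

Lemma same_tp_take s1 s2 t1 t2 : size s1 = size t1 ->
  same_tp (s1 ++ s2) (t1 ++ t2) -> same_tp s1 t1.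
Proof.
move=> e h; have := same_tp_map (js := iota 0 (size s1)) h.
rewrite !map_nth_iota0 ?size_cat ?e ?leq_addr // -{1}e !take_size_cat //.
apply; apply/allP => i; rewrite mem_iota add0n => /andP[_ lt_i].
by rewrite -e in lt_i *; exact: ltn_addr.
Qed.

Lemma same_tp_remove s1 s2 s3 t1 t2 t3 : size s1 = size t1 -> size s2 = size t2 ->
  same_tp (s1 ++ s2 ++ s3) (t1 ++ t2 ++ t3) -> same_tp (s1 ++ s3) (t1 ++ t3).
Proof.
move=> e1 e2 h; have e3 : size s3 = size t3.
  by have /eqP := same_tp_size h; rewrite !size_cat e1 e2 !eqn_add2l => /eqP.
have := same_tp_map (js := iota 0 (size s1) ++ iota (size s1 + size s2) (size s3)) h.
rewrite nth_remove e1 e2 e3 nth_remove; apply.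
rewrite !size_cat all_cat; apply/andP; split; apply/allP => i.
  by rewrite mem_iota add0n e1 => /andP[_ lt_i]; rewrite ltn_addr.
by rewrite mem_iota e1 e2 e3 addnA => /andP[].
Qed.

Lemma same_tp_value s t n (u : rterm n) : (n <= size s)%N -> same_tp s t ->
  (value s u == 0) = (value t u == 0).
Proof.
move=> le_n [k [a [b [es et /tp_eqP ab]]]]; rewrite es size_tuple in le_n.
rewrite es et !(value_tuple _ le_n); set v := rename_term _ _.
by have /= [h1 h2] := ab (Equal v (tzero k)); apply/eqP/eqP.
Qed.

Lemma same_tp_nonzero s t n (u : rterm n.+1) : (n <= size s)%N -> same_tp s t ->
  (exists x, value (x :: s) u != 0) -> exists y, value (y :: t) u != 0.
Proof.
move=> le_n [k [a [b [es et /tp_eqP ab]]]] [x]; rewrite es size_tuple in le_n.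
have le_n1 : (n.+1 <= k.+1)%N by [].
rewrite es et -[x :: a]/(tval [tuple of x :: a]) (value_tuple _ le_n1).
set v := rename_term _ _ => /eqP vx.
have /ab [y vy] : @holds _ KS _ (Exists (Not (Equal v (tzero k.+1)))) a by exists x.
exists y; rewrite -[y :: b]/(tval [tuple of y :: b]) (value_tuple _ le_n1); exact/eqP.
Qed.

End SameTp.

Lemma zeros_finite (L : rcfType) n (u : rterm n.+1) (t : seq L) : (n <= size t)%N ->
  (exists y, value (y :: t) u != 0) ->
  exists zs : seq L, forall y, value (y :: t) u = 0 -> y \in zs.
Proof.
move=> le_n.
have le_n1 : (n.+1 <= (size t).+1)%N by [].
have [p [_ [_ pE _]]] := @teval_poly L L _ (in_tuple t) (in_tuple t) (fun=> erefl)
  (rename_term (widen_ord le_n1) u).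
have {}pE y : value (y :: t) u = p.[y].
  by rewrite -pE -value_tuple.
case=> y0; rewrite pE => py0; exists (rootsR p) => y; rewrite pE => /eqP py.
rewrite -roots_on_rootsR //.
by apply: contraNneq py0 => ->; rewrite horner0.
Qed.

Lemma same_tp_algebraic (K L : rcfType) (s : seq K) (t : seq L) n (u : rterm n.+1) x :
  (n <= size s)%N -> same_tp s t -> (exists x0, value (x0 :: s) u != 0) ->
  value (x :: s) u = 0 -> exists y, same_tp (x :: s) (y :: t).
Proof.
move=> le_n st u_neq0 ux; have := same_tp_nonzero le_n st u_neq0.
have est := same_tp_size st.
move=> /zeros_finite -/(_ _) [|zs zsP]; first by rewrite -est.
case: st => k [a [b [es et ab]]].
rewrite es size_tuple in le_n; have le_n1 : (n.+1 <= k.+1)%N by [].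
rewrite es et in zsP ux *.
rewrite -[x :: a]/(tval [tuple of x :: a]) (value_tuple _ le_n1) in ux.
have [||y xy] := @tp_extend _ (ring_structure K) (ring_structure L) k a b
  (Equal (rename_term (widen_ord le_n1) u) (tzero k.+1)) x zs ab.
- exact: ux.
- move=> y hy; have : y \in zs.
    by apply: zsP; rewrite -[y :: b]/(tval [tuple of y :: b]) (value_tuple _ le_n1); exact: hy.
  by elim: zs {zsP} => //= z zs IH; rewrite inE => /orP[/eqP -> |/IH]; [left | right].
by exists y; apply/same_tp_tuple.
Qed.

Section Algebraic.
Variables (K L : rcfType) (T : K -> Prop).

(** Over any copy [b] of a tuple [a] containing [g], the type of [xs] over [a] is
    realized by some and by only finitely many tuples. *)
Definition tp_algebraic_over (g : seq K) (xs : seq K) :=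
  forall (a : seq K) (b : seq L), {subset g <= a} -> same_tp a b ->
    (exists ys, size ys = size xs /\ same_tp (xs ++ a) (ys ++ b)) /\
    (exists zs : seq (seq L), forall ys, size ys = size xs ->
       same_tp (xs ++ a) (ys ++ b) -> ys \in zs).

Definition tp_algebraic xs := exists g, (forall x, x \in g -> T x) /\ tp_algebraic_over g xs.

Lemma tp_algebraic_cons x xs : tp_algebraic [:: x] -> tp_algebraic xs -> tp_algebraic (x :: xs).
Proof.
move=> [gx [gxT hx]] [g [gT h]]; exists (gx ++ g); split.
  by move=> z; rewrite mem_cat => /orP[/gxT | /gT].
move=> a b gab ab.
have ga : {subset g <= a} by move=> z zg; apply: gab; rewrite mem_cat zg orbT.
have gxa : {subset gx <= a} by move=> z zg; apply: gab; rewrite mem_cat zg.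
have [[ys [sz_ys st]] [zs zsP]] := h _ _ ga ab; split.
  have gxa' : {subset gx <= xs ++ a} by move=> z /gxa za; rewrite mem_cat za orbT.
  have [[y' [sz_y' sty]] _] := hx _ _ gxa' st.
  by exists (y' ++ ys); rewrite size_cat sz_y' sz_ys -catA.
have [_ [zx zxP]] := hx _ _ gxa ab.
exists [seq y ++ ys | y <- zx, ys <- zs] => -[//|y ys'] [sz_ys'] st'.
rewrite -cat1s; apply: allpairs_f.
  apply: zxP => //.
  apply: (@same_tp_remove _ _ [:: x] xs a [:: y] ys' b) => //.
apply: zsP => //.
by apply: (@same_tp_drop _ _ [:: x] (xs ++ a) [:: y] (ys' ++ b)).
Qed.

Lemma tp_algebraic_nil : tp_algebraic [::].
Proof.
exists [::]; split=> // a b _ ab; split; first by exists [::].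
by exists [:: [::]] => -[|//]; rewrite inE.
Qed.

Lemma tp_algebraic_seq xs : (forall x, x \in xs -> tp_algebraic [:: x]) -> tp_algebraic xs.
Proof.
elim: xs => [_|x xs IH h]; first exact: tp_algebraic_nil.
by apply: tp_algebraic_cons; [|apply: IH => z zxs]; apply: h; rewrite inE ?eqxx ?zxs ?orbT.
Qed.

Lemma tp_algebraic_gen x : T x -> tp_algebraic [:: x].
Proof.
move=> Tx; exists [:: x]; split=> [z|a b xa ab]; first by rewrite inE => /eqP ->.
have {}xa : x \in a by apply: xa; rewrite inE.
have lt_i : (index x a < size a)%N by rewrite index_mem.
split.
  exists [:: b`_(index x a)]; split=> //.
  have := same_tp_map (js := index x a :: iota 0 (size a)) ab.
  have eb : [seq b`_j | j <- iota 0 (size a)] = b by rewrite (same_tp_size ab); exact: mkseq_nth.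
  rewrite !map_cons eb (mkseq_nth 0 a : map _ _ = a) nth_index //; apply.
  by rewrite /= index_mem xa /=; apply/allP => i; rewrite mem_iota.
exists [:: [:: b`_(index x a)]] => -[|y [|//]] // _ st; rewrite inE eqseq_cons eqxx andbT.
have := same_tp_map (js := [:: 0; (index x a).+1]%N) st.
rewrite /= nth_index // ltnS index_mem xa => /(_ isT) /(@same_tp_value _ _ _ _ 2) e.
have := e (tsub (tvar ord0) (tvar ord_max)) isT.
rewrite /value !teval_sub !teval_var !tnth_mktuple /= subrr eqxx.
by rewrite subr_eq0 => <-.
Qed.

(** Transitivity of algebraicity, for a nontrivial equation [u] with parameters
    [xs]. Every realization [y] extends to a realization [y :: ys] of the type of
    [x :: xs]; there are finitely many [ys], and finitely many zeros of [u] for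
    each of them. *)
Lemma tp_algebraic_step n (u : rterm n.+1) (xs : seq K) (x : K) : size xs = n ->
  (forall z, z \in xs -> tp_algebraic [:: z]) ->
  (exists x0, value (x0 :: xs) u != 0) -> value (x :: xs) u = 0 -> tp_algebraic [:: x].
Proof.
move=> sz_xs xs_alg u_neq0 ux; have [g [gT h]] := tp_algebraic_seq xs_alg.
exists g; split=> // a b ga ab; have [[ys [sz_ys st]] [zs zsP]] := h _ _ ga ab.
have value_cat (R : nzRingType) (v s : seq R) : size v = n.+1 -> value (v ++ s) u = value v u.
  move=> sz_v; congr teval; apply: eq_from_tnth => i; rewrite !tnth_mktuple nth_cat sz_v.
  by rewrite ltn_ord.
split.
  have [|||y sty] := @same_tp_algebraic K L (xs ++ a) (ys ++ b) n u x _ st.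
  - by rewrite size_cat sz_xs leq_addr.
  - by have [x0 ux0] := u_neq0; exists x0; rewrite -cat_cons value_cat //= sz_xs.
  - by rewrite -cat_cons value_cat //= sz_xs.
  exists [:: y]; split=> //.
  by apply: (@same_tp_remove _ _ [:: x] xs a [:: y] ys b).
have /choice [zeros zerosP] : forall ys : seq L, exists rs : seq L,
    (n <= size ys)%N -> (exists y, value (y :: ys) u != 0) ->
    forall y, value (y :: ys) u = 0 -> y \in rs.
  move=> ys'; case: (pselect ((n <= size ys')%N /\ exists y, value (y :: ys') u != 0)).
    by move=> [le_n ex]; have [rs rsP] := zeros_finite le_n ex; exists rs.
  by move=> no; exists [::] => le_n ex; case: no.
exists [seq [:: y] | y <- flatten [seq zeros ys' | ys' <- zs]] => -[|y [|//]] // _ sty.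
have ga' : {subset g <= x :: a} by move=> z /ga za; rewrite inE za orbT.
have [[ys' [sz_ys' st']] _] := h _ _ ga' sty.
apply: map_f; apply/flattenP; exists (zeros ys').
  apply/map_f/zsP => //.
  exact: (@same_tp_remove _ _ xs [:: x] a ys' [:: y] b).
have stx : same_tp xs ys' by exact: same_tp_take st'.
have stxy : same_tp (x :: xs) (y :: ys').
  have := same_tp_map (js := n :: iota 0 n) st'.
  rewrite /= !nth_cat sz_ys' sz_xs ltnn subnn /= !map_nth_iota0 ?size_cat ?sz_ys' ?sz_xs ?leq_addr //.
  rewrite -{1}sz_xs take_size_cat // -[in take n _]sz_xs take_size_cat ?sz_ys' //; apply.
  rewrite sz_xs /= addnS ltnS leq_addr /=; apply/allP => i.
  by rewrite mem_iota add0n ltnS => /andP[_ /ltnW le_i]; rewrite (leq_trans le_i) ?leq_addr.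
apply: zerosP; first by rewrite sz_ys' sz_xs.
  by apply: same_tp_nonzero stx u_neq0; rewrite sz_xs.
by apply/eqP; rewrite -(same_tp_value _ _ stxy) ?ux //= sz_xs.
Qed.

Lemma tp_algebraic1 : tp_algebraic [:: 1].
Proof.
pose u : rterm 1 := tsub (tvar ord0) (tone 1).
have uE (x : K) : value [:: x] u = x - 1.
  by rewrite /value teval_sub teval_one -/(value _ _) value_cons0.
apply: (tp_algebraic_step (u := u) (xs := [::])) => //; last by rewrite uE subrr.
by exists 0; rewrite uE sub0r oppr_eq0 oner_eq0.
Qed.

Lemma tp_algebraic_op2 (f : K -> K -> K) (v : rterm 2) x y :
  (forall z w, f z w = value [:: z; w] v) ->
  tp_algebraic [:: x] -> tp_algebraic [:: y] -> tp_algebraic [:: f x y].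
Proof.
move=> fE ax ay.
pose u : rterm 3 := tsub (tvar ord0) (rename_term (lift ord0) v).
have uE z : value [:: z; x; y] u = z - f x y.
  rewrite /value teval_sub -/(value _ _) value_cons0 fE teval_rename; congr (_ - teval _ _).
  by apply: eq_from_tnth => i; rewrite !tnth_mktuple.
apply: (tp_algebraic_step (u := u) (xs := [:: x; y])) => //; last by rewrite uE subrr.
  by move=> z; rewrite !inE => /orP[] /eqP ->.
by exists (f x y + 1); rewrite uE addrAC subrr add0r oner_eq0.
Qed.

Lemma tp_algebraicB x y : tp_algebraic [:: x] -> tp_algebraic [:: y] -> tp_algebraic [:: x - y].
Proof.
apply: (tp_algebraic_op2 (f := fun z w => z - w) (v := tsub (tvar ord0) (tvar ord_max))) => z w.
by rewrite /value teval_sub !teval_var !tnth_mktuple.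
Qed.

Lemma tp_algebraicM x y : tp_algebraic [:: x] -> tp_algebraic [:: y] -> tp_algebraic [:: x * y].
Proof.
apply: (tp_algebraic_op2 (f := fun z w => z * w) (v := tmul (tvar ord0) (tvar ord_max))) => z w.
by rewrite /value teval_mul !teval_var !tnth_mktuple.
Qed.

(** The general polynomial with [n] coefficients: variable 0 is the unknown, the
    others are the coefficients. *)
Definition horner_term n : rterm n.+1 :=
  foldr (fun i acc => tadd (tmul acc (tvar ord0)) (tvar (lift ord0 i))) (tzero n.+1) (enum 'I_n).

Lemma value_horner_term (p : {poly K}) x : value (x :: p) (horner_term (size p)) = p.[x].
Proof.
rewrite -[p in RHS]polyseqK -[X in Poly X](mkseq_nth 0 p) /mkseq -val_enum_ord -map_comp.
rewrite /horner_term; elim: (enum _) => [|i s IH] /=; first by rewrite /value teval_zero horner0.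
rewrite cons_poly_def hornerMXaddC -IH /value teval_add teval_mul -!/(value _ _).
by rewrite value_cons0 value_consS.
Qed.

Lemma tp_algebraic_root (p : {poly K}) x : p != 0 -> (forall i, tp_algebraic [:: p`_i]) ->
  root p x -> tp_algebraic [:: x].
Proof.
move=> p_neq0 pa /eqP px; apply: (tp_algebraic_step (u := horner_term (size p)) (xs := p)) => //.
- by move=> _ /(nthP 0) [i _ <-].
- exists (cauchy_bound p); rewrite value_horner_term.
  (* Beyond all its roots, [p] does not vanish. *)
  by apply: ge_cauchy_bound => //; rewrite in_itv /= lexx.
by rewrite value_horner_term.
Qed.

End Algebraic.

Section Consequences.
Variables (K L : rcfType) (T : K -> Prop).
Hypothesis algK : forall x : K, tp_algebraic L T [:: x].

(** Finite tuples are algebraic over rapid ones, and rapid tuples of the same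
    length have the same type. *)
Lemma transfer_tp :
  (forall g : seq K, (forall x, x \in g -> T x) ->
     exists k (r : k.-tuple K), rapid r /\ {subset g <= r}) ->
  (forall k, exists r : k.-tuple L, rapid r) ->
  forall k (a : k.-tuple K), exists b : k.-tuple L,
    @tp _ (ring_structure K) _ a = @tp _ (ring_structure L) _ b.
Proof.
move=> rapidK rapidL k a; have [g [gT h]] :=
  tp_algebraic_seq (fun z (_ : z \in (a : seq K)) => algK z).
have [m [r [rr gr]]] := rapidK g gT; have [r' rr'] := rapidL m.
have [|[b [sz_b st]] _] := h r r' gr; first by apply/same_tp_tuple; exact: rapid_tp.
have sz_b' : size b == k by rewrite sz_b size_tuple.
exists (Tuple sz_b'); apply/same_tp_tuple; apply: same_tp_take st.
by rewrite (eqP sz_b') size_tuple.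
Qed.

(** An [x] beyond all powers of [M] would make [x :: r] rapid, and so would have
    the same type over [r] as infinitely many elements of [L] over a copy of
    [r], although it is algebraic over [r]. *)
Lemma tp_algebraic_bounded :
  (forall k, exists r : k.-tuple L, rapid r /\
     forall N, exists ys : seq L, [/\ uniq ys, (N < size ys)%N & {in ys, forall y, above r y}]) ->
  forall x, exists g : seq K, (forall z, z \in g -> T z) /\
   forall k (r : k.-tuple K) (M : K), {subset g <= r} -> rapid r -> 2 <= M ->
     (forall i, `|tnth r i| <= M) -> exists n : nat, x <= M ^+ n.
Proof.
move=> tallL x; have [g [gT h]] := algK x; exists g; split=> // k r M gr rr M2 rM.
apply: contrapT => /forallNP noM.
have xr : above r x.
  by apply: (above_pow M2 rM) => n; rewrite ltNge; apply/negP; exact: noM.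
have rxr : rapid [tuple of x :: r] by apply/rapid_consE.
have [r' [rr' many]] := tallL k.
have [|_ [zs zsP]] := h r r' gr; first by apply/same_tp_tuple; exact: rapid_tp.
have [ys [uniq_ys lt_ys ys_above]] := many (size zs).
suff /uniq_leq_size : {subset [seq [:: y] | y <- ys] <= zs}.
  rewrite map_inj_uniq; last by move=> u v [].
  by move=> /(_ uniq_ys); rewrite size_map leqNgt lt_ys.
move=> _ /mapP [y y_in ->]; apply: zsP => //.
have ry : rapid [tuple of y :: r'] by apply/rapid_consE; split=> //; exact: ys_above.
by apply/(same_tp_tuple [tuple of x :: r] [tuple of y :: r']); exact: rapid_tp.
Qed.

End Consequences.

(** * Countable real closures of generated subfields *)

Section RealClosure.
Variables (H : rcfType) (gen : nat -> H).

(** A code describes the construction of an element from the generators by ring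
    operations and roots of polynomials: [Node n.+3 cs] is root number [n] of the
    polynomial with coefficients [cs]. Codes give countability at once. *)
Fixpoint code_val (c : GenTree.tree nat) : H :=
  match c with
  | GenTree.Leaf i => gen i
  | GenTree.Node 0 _ => 1
  | GenTree.Node 1 [:: c1; c2] => code_val c1 - code_val c2
  | GenTree.Node 2 [:: c1; c2] => code_val c1 * code_val c2
  | GenTree.Node n.+3 cs => (rootsR (Poly (map code_val cs)))`_n
  | _ => 0
  end.

Definition closure : {pred H} := fun x => `[< exists c, code_val c = x >].

Lemma closureP x : reflect (exists c, code_val c = x) (x \in closure).
Proof. exact: asboolP. Qed.

Lemma closure_gen i : gen i \in closure.
Proof. by apply/closureP; exists (GenTree.Leaf i). Qed.

Lemma closure1 : 1 \in closure.
Proof. by apply/closureP; exists (GenTree.Node 0 [::]). Qed.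

Lemma closureB : {in closure &, forall x y, x - y \in closure}.
Proof.
by move=> _ _ /closureP [c <-] /closureP [d <-]; apply/closureP; exists (GenTree.Node 1 [:: c; d]).
Qed.

Lemma closureM : {in closure &, forall x y, x * y \in closure}.
Proof.
by move=> _ _ /closureP [c <-] /closureP [d <-]; apply/closureP; exists (GenTree.Node 2 [:: c; d]).
Qed.

Lemma closure0 : 0 \in closure.
Proof. by rewrite -(subrr 1); apply: closureB; exact: closure1. Qed.

Lemma closure_root (p : {poly H}) x : p != 0 -> (forall i, p`_i \in closure) ->
  root p x -> x \in closure.
Proof.
move=> p_neq0 pS px0.
have [cs csE] : exists cs, map code_val cs = p.
  have : all (mem closure) p.
    by apply/(all_nthP 0) => i _; exact: pS.
  elim: (polyseq p) => [_|y s IH /= /andP[/closureP [c <-] /IH [cs <-]]]; first by exists [::].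
  by exists (c :: cs).
have x_in : x \in rootsR p by rewrite -roots_on_rootsR.
apply/closureP; exists (GenTree.Node (index x (rootsR p)).+3 cs) => /=.
by rewrite csE polyseqK nth_index.
Qed.

(** The inverse of [x] is the root of [x *: 'X - 1]. *)
Lemma closureV x : x \in closure -> x^-1 \in closure.
Proof.
have [->|x_neq0] := eqVneq x 0; first by rewrite invr0.
move=> xS; apply: (@closure_root (x *: 'X - 1%:P)).
- by rewrite -size_poly_gt0 size_polyDl ?size_scale ?size_polyX // size_polyN size_polyC oner_eq0.
- move=> i; rewrite coefB coefZ coefX coefC; apply: closureB; last first.
    by case: eqP => _; [exact: closure1 | exact: closure0].
  by case: eqP => _; rewrite ?mulr1 ?mulr0 //; exact: closure0.
by rewrite /root !hornerE mulfV // subrr.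
Qed.

Lemma closure_divring : divring_closed closure.
Proof.
split; [exact: closure1 | exact: closureB | move=> x y xS yS].
by apply: closureM => //; exact: closureV.
Qed.
HB.instance Definition _ := GRing.isDivringClosed.Build H closure closure_divring.

Record real_closure : Type := RealClosure { rc_val :> H; rc_valP : rc_val \in closure }.

HB.instance Definition _ := [isSub for rc_val].
HB.instance Definition _ := [Choice of real_closure by <:].
HB.instance Definition _ := [SubChoice_isSubIntegralDomain of real_closure by <:].
HB.instance Definition _ := [SubIntegralDomain_isSubField of real_closure by <:].

Definition rc_le (x y : real_closure) := rc_val x <= rc_val y.
Definition rc_lt (x y : real_closure) := rc_val x < rc_val y.
Lemma rc_norm_subproof (x : real_closure) : `|rc_val x| \in closure.
Proof. by case: (ger0P (rc_val x)) => _; rewrite ?rpredN; exact: rc_valP. Qed.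
Definition rc_norm (x : real_closure) := RealClosure (rc_norm_subproof x).

Fact rc_le0_add x y : rc_le 0 x -> rc_le 0 y -> rc_le 0 (x + y).
Proof. exact: addr_ge0. Qed.
Fact rc_le0_mul x y : rc_le 0 x -> rc_le 0 y -> rc_le 0 (x * y).
Proof. exact: mulr_ge0. Qed.
Fact rc_le0_anti x : rc_le 0 x -> rc_le x 0 -> x = 0.
Proof. by move=> h1 h2; apply/val_inj/le_anti/andP. Qed.
Fact rc_sub_ge0 x y : rc_le 0 (y - x) = rc_le x y.
Proof. exact: subr_ge0. Qed.
Fact rc_le0_total x : rc_le 0 x || rc_le x 0.
Proof. exact: le_total. Qed.
Fact rc_normN x : rc_norm (- x) = rc_norm x.
Proof. by apply/val_inj; exact: normrN. Qed.
Fact rc_ge0_norm x : rc_le 0 x -> rc_norm x = x.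
Proof. by move=> x0; apply/val_inj; exact: ger0_norm. Qed.
Fact rc_lt_def x y : rc_lt x y = (y != x) && rc_le x y.
Proof. exact: lt_def. Qed.

HB.instance Definition _ := Num.IntegralDomain_isLeReal.Build real_closure
  rc_le0_add rc_le0_mul rc_le0_anti rc_sub_ge0 rc_le0_total
  rc_normN rc_ge0_norm rc_lt_def.

Lemma rc_root_val (p : {poly real_closure}) (x : real_closure) :
  root p x = root (map_poly (val : real_closure -> H) p) (val x).
Proof. by rewrite /root horner_map -(inj_eq val_inj) rmorph0. Qed.

Lemma rc_ivt : Num.real_closed_axiom real_closure.
Proof.
move=> p a b le_ab /andP[pa pb].
have hE (z : real_closure) : val p.[z] = (map_poly (val : real_closure -> H) p).[val z].
  by rewrite horner_map.
have [//||z z_in pz0] := @poly_ivt _ (map_poly (val : real_closure -> H) p) (val a) (val b).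
  by rewrite -!hE; apply/andP.
have [p0|p_neq0] := eqVneq p 0; first by exists a; rewrite ?lexx ?le_ab // p0 root0.
have zS : z \in closure.
  apply: closure_root pz0; first by rewrite map_poly_eq0.
  by move=> i; rewrite coef_map; exact: rc_valP.
by exists (RealClosure zS); [exact: z_in | rewrite rc_root_val].
Qed.

HB.instance Definition _ := Num.RealField_isClosed.Build real_closure rc_ivt.

Definition rc_gen i : real_closure := RealClosure (closure_gen i).

(** Induction on codes, expressed inside the real closure: inverses are roots. *)
Lemma rc_ind (P : real_closure -> Prop) :
  (forall i, P (rc_gen i)) -> P 1 -> (forall x y, P x -> P y -> P (x - y)) ->
  (forall x y, P x -> P y -> P (x * y)) ->
  (forall (p : {poly real_closure}) x, p != 0 -> (forall i, P p`_i) -> root p x -> P x) ->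
  forall x, P x.
Proof.
move=> Pgen P1 PB PM Proot.
have P0 : P 0 by rewrite -(subrr 1); exact: PB.
suff PS c : exists2 x : real_closure, val x = code_val c & P x.
  by move=> x; have /closureP [c cx] := rc_valP x; have [y yx Py] := PS c;
     have <- : y = x by apply/val_inj; rewrite yx.
elim: c => [i|n cs IH]; first by exists (rc_gen i).
have {IH} [xs xsE Pxs] : exists2 xs : seq real_closure, map val xs = map code_val cs &
    forall i, P xs`_i.
  elim: cs IH => [_|c cs IHcs /= [[x xE Px] /IHcs [xs xsE Pxs]]].
    by exists [::] => // i; rewrite nth_nil.
  exists (x :: xs); first by rewrite /= xsE -xE.
  by case.
case: n => [|[|[|n]]]; first by exists 1.
- case: cs xsE => [|c [|d [|e cs]]]; try by exists 0.
  case: xs Pxs => [//|x [//|y [|//]]] Pxs [xE yE].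
  by exists (x - y); [rewrite /= -xE -yE | exact: PB (Pxs 0) (Pxs 1)].
- case: cs xsE => [|c [|d [|e cs]]]; try by exists 0.
  case: xs Pxs => [//|x [//|y [|//]]] Pxs [xE yE].
  by exists (x * y); [rewrite /= -xE -yE | exact: PM (Pxs 0) (Pxs 1)].
have pE : Poly (map code_val cs) = map_poly (val : real_closure -> H) (Poly xs).
  apply/polyP => i; rewrite coef_map !coef_Poly -xsE /=.
  have [lt_i|le_i] := ltnP i (size xs); first by rewrite (nth_map 0).
  by rewrite !nth_default ?size_map // rmorph0.
have Pp i : P (Poly xs)`_i by rewrite coef_Poly.
rewrite /= pE; set q := map_poly _ _; have [p0|p_neq0] := eqVneq (Poly xs) 0.
  exists 0 => //; rewrite /q p0 map_poly0.
  by rewrite /rootsR roots0 nth_nil.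
have q_neq0 : q != 0 by rewrite map_poly_eq0.
have [lt_n|le_n] := ltnP n (size (rootsR q)); last by exists 0; rewrite ?nth_default ?rmorph0.
have : root q (rootsR q)`_n.
  by have := mem_nth 0 lt_n; rewrite -roots_on_rootsR.
have [z zE] : exists z : real_closure, val z = (rootsR q)`_n.
  have zS : (rootsR q)`_n \in closure.
    apply/closureP; exists (GenTree.Node n.+3 cs) => /=.
    by rewrite pE.
  by exists (RealClosure zS).
rewrite -zE -rc_root_val => pz0; exists z => //.
exact: Proot pz0.
Qed.

Lemma rc_code_subproof : exists f : real_closure -> GenTree.tree nat,
  forall x, code_val (f x) = val x.
Proof.
suff /choice [f fP] : forall x : real_closure, exists c, code_val c = val x by exists f.
by move=> x; exact/closureP/rc_valP.
Qed.

Definition rc_code : real_closure -> GenTree.tree nat := sval (cid rc_code_subproof).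

Lemma rc_codeK : pcancel rc_code (fun c => insub (code_val c) : option real_closure).
Proof. by move=> x; rewrite /rc_code (svalP (cid rc_code_subproof)) valK. Qed.

HB.instance Definition _ := PCanIsCountable rc_codeK.

End RealClosure.

(** * Rapid chains *)

Section Chain.
Variables (K : rcfType) (t : nat -> K).

(** Starting above the powers of 2 makes [t 0] exceed all integers, the values of
    terms without variables. *)
Definition rapid_chain := (forall n, 2 ^+ n < t 0) /\ (forall i n, t i ^+ n < t i.+1).

Fixpoint chain k : k.-tuple K :=
  if k is k'.+1 then [tuple of t k' :: chain k'] else [tuple].

Hypothesis rt : rapid_chain.

Lemma chain_lt i : t i < t i.+1.
Proof. by have := rt.2 i 1%N; rewrite expr1. Qed.

Lemma chain_le i j : (i <= j)%N -> t i <= t j.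
Proof.
elim: j => [|j IH]; first by case: i.
by rewrite leq_eqVlt => /orP[/eqP ->//|/IH/le_trans]; apply; exact/ltW/chain_lt.
Qed.

Lemma chain_inj : injective t.
Proof.
move=> i j; wlog lt_ij : i j / (i < j)%N.
  by move=> W tij; case: (ltngtP i j) => [lt|lt|//]; [exact: W | apply/esym/W].
by move=> e; have := lt_le_trans (chain_lt i) (chain_le lt_ij); rewrite e ltxx.
Qed.

Lemma chain_ge2 i : 2 <= t i.
Proof. by apply: le_trans (chain_le (leq0n i)); have := rt.1 1%N; rewrite expr1 => /ltW. Qed.

Lemma mem_chain k i : (i < k)%N -> t i \in (chain k : seq K).
Proof.
elim: k => //= k IH; rewrite inE ltnS leq_eqVlt => /orP[/eqP ->|/IH ->]; rewrite ?eqxx ?orbT //.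
Qed.

Lemma chain_abs_le k x : x \in (chain k.+1 : seq K) -> `|x| <= t k.
Proof.
have pos i : 0 <= t i by apply: le_trans (chain_ge2 i).
elim: k => [|k IH]; rewrite /= in_cons => /orP[/eqP ->|//]; try by rewrite ger0_norm.
by move=> xk; apply: le_trans (IH xk) _; exact/ltW/chain_lt.
Qed.

Lemma chain_above k x : (forall i n, (i < k)%N -> t i ^+ n < x) -> (forall n, 2 ^+ n < x) ->
  above (chain k) x.
Proof.
case: k => [|k] tx x2; first by apply: (above_pow (lexx 2)) => // -[].
apply: (above_pow (chain_ge2 k)) => [i|n]; last exact: tx.
by apply: chain_abs_le; exact: mem_tnth.
Qed.

Lemma chain_pow i j n : (i < j)%N -> t i ^+ n < t j.
Proof. by move=> lt_ij; apply: lt_le_trans (rt.2 i n) (chain_le lt_ij). Qed.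

Lemma chain_pow2 j n : 2 ^+ n < t j.
Proof. exact: lt_le_trans (rt.1 n) (chain_le (leq0n j)). Qed.

Lemma above_chain k j : (k <= j)%N -> above (chain k) (t j).
Proof.
move=> le_kj; apply: chain_above => [i n lt_i|n]; last exact: chain_pow2.
exact: chain_pow (leq_trans lt_i le_kj).
Qed.

Lemma rapid_chainP k : rapid (chain k).
Proof. by elim: k => // k IH; apply/rapid_consE; split=> //; exact: above_chain. Qed.

(** The hypothesis of [tp_algebraic_bounded] on the target: infinitely many
    members of the chain lie above any initial segment. *)
Lemma chain_tall k : exists r : k.-tuple K, rapid r /\
  forall N, exists ys : seq K, [/\ uniq ys, (N < size ys)%N & {in ys, forall y, above r y}].
Proof.
exists (chain k); split; first exact: rapid_chainP.
move=> N; exists [seq t j | j <- iota k N.+1]; split.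
- by rewrite map_inj_uniq ?iota_uniq //; exact: chain_inj.
- by rewrite size_map size_iota.
by move=> _ /mapP [j + ->]; rewrite mem_iota => /andP[le_kj _]; exact: above_chain.
Qed.

End Chain.

(** Along a nonprincipal ultrafilter on the natural numbers, comparing two classes
    means comparing exponents for large [n], and
    k * n^(i+1) < n^(i+2) <= n^n as soon as n > k and n >= i+2. *)
Lemma exists_chain_and_bound : exists (H : rcfType) (t : nat -> H) (w : H),
  rapid_chain t /\ forall i n, t i ^+ n < w.
Proof.
pose F (A : set nat) := exists N, forall n, (N <= n)%N -> A n.
have PF : ProperFilter F.
  split; first by move=> [N /(_ N (leqnn N))].
  split; first by exists 0%N.
    move=> A B [N hN] [M hM]; exists (maxn N M) => n.
    by rewrite geq_max => /andP[? ?]; split; [exact: hN | exact: hM].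
  by move=> A B AB [N hN]; exists N => n /hN /AB.
have [G [UG FG]] := ultraFilterLemma PF.
pose U := MkUltrafilter UG.
have eventually (A : nat -> Prop) N : (forall n, (N <= n)%N -> A n) -> U A.
  by move=> h; apply: FG; exists N.
pose R : rcfType := {realclosure rat}.
pose H : rcfType := ultrapower U R.
pose c (e : nat -> nat) : H := cls U (fun n => (2 ^ e n)%:R : R).
have cX e n : c e ^+ n = c (fun m => e m * n)%N.
  elim: n => [|n IH]; first by rewrite expr0 /c cls1; apply/clsP/largeT => m; rewrite muln0.
  rewrite exprS IH /c clsM; apply/clsP/largeT => m.
  by rewrite mulnS expnD natrM.
have c_lt e f N : (forall n, (N <= n)%N -> (e n < f n)%N) -> c e < c f.
  move=> ef; apply/cls_ltP/(eventually _ N) => n /ef lt_n.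
  by rewrite ltr_nat ltn_exp2l.
have c2 n : 2 ^+ n = c (fun=> n).
  have -> : 2 = c (fun=> 1%N) by rewrite -[2]/(1 + 1) cls1 clsD.
  by rewrite cX; apply/clsP/largeT => m; rewrite mul1n.
exists H, (fun i => c (fun n => n ^ i.+1)%N), (c (fun n => n ^ n)%N).
split; [split=> [n|i n] | move=> i n].
- by rewrite c2; apply: (c_lt _ _ n.+1) => m lt_m; rewrite expn1.
- rewrite cX; apply: (c_lt _ _ n.+1) => m lt_m.
  by rewrite [X in (_ < X)%N]expnSr ltn_pmul2l // expn_gt0 (leq_ltn_trans _ lt_m).
rewrite cX; apply: (c_lt _ _ (maxn n.+1 i.+2)) => m; rewrite geq_max => /andP[lt_n lt_i].
apply: (@leq_trans (m ^ i.+2)); last by rewrite leq_exp2l // (leq_trans _ lt_i).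
by rewrite [X in (_ < X)%N]expnSr ltn_pmul2l // expn_gt0 (leq_ltn_trans _ lt_n).
Qed.

Lemma rc_algebraic (H : rcfType) (gen : nat -> H) (L : rcfType) (x : real_closure gen) :
  tp_algebraic L (fun z => exists i, z = rc_gen gen i) [:: x].
Proof.
elim/rc_ind: x => [i||x y|x y|p x]; first by apply: tp_algebraic_gen; exists i.
- exact: tp_algebraic1.
- exact: tp_algebraicB.
- exact: tp_algebraicM.
exact: tp_algebraic_root.
Qed.

Lemma subset_bounded (V : eqType) (g : seq V) (P : V -> nat -> Prop) :
  (forall x i j, (i <= j)%N -> P x i -> P x j) ->
  (forall x, x \in g -> exists i, P x i) -> exists i, forall x, x \in g -> P x i.
Proof.
move=> P_le; elim: g => [_|x g IH gP]; first by exists 0%N.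
have [i Pi] := gP x (mem_head _ _).
have [z zg|j Pj] := IH; first by apply: gP; rewrite inE zg orbT.
exists (maxn i j) => z; rewrite inE => /orP[/eqP ->|/Pj].
  by apply: P_le Pi; exact: leq_maxl.
by apply: P_le; exact: leq_maxr.
Qed.

(** The order is definable: nonnegative elements are squares. *)
Lemma rmorph_rcf_le (K F : rcfType) (f : {rmorphism K -> F}) : {homo f : x y / x <= y}.
Proof.
move=> x y; rewrite -subr_ge0 => /sqr_sqrtr xy.
by rewrite -subr_ge0 -rmorphB -xy rmorphXn sqr_ge0.
Qed.

(** * The two fields *)

Section TwoClosures.
Variables (H : rcfType) (t : nat -> H) (w : H).
Hypotheses (rt : rapid_chain t) (tw : forall i n, t i ^+ n < w).

Definition with_top i := if i is j.+1 then t j else w.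

Notation tall := (real_closure t).
Notation short := (real_closure with_top).

Let tK (i : nat) : tall := rc_gen t i.
Let tF (i : nat) : short := rc_gen with_top i.+1.
Let wF : short := rc_gen with_top 0.

Let TK z := exists i, z = tK i.
Let TF z := exists i, z = rc_gen with_top i.

Lemma tall_chain : rapid_chain tK.
Proof.
split=> [n|i n]; [have := rt.1 n | have := rt.2 i n].
  by rewrite -[t 0]/(val (tK 0)) -[2](rmorph_nat (val : tall -> H)) -rmorphXn.
by rewrite -[t i]/(val (tK i)) -[t i.+1]/(val (tK i.+1)) -rmorphXn.
Qed.

Lemma short_chain : rapid_chain tF.
Proof.
split=> [n|i n]; [have := rt.1 n | have := rt.2 i n].
  by rewrite -[t 0]/(val (tF 0)) -[2](rmorph_nat (val : short -> H)) -rmorphXn.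
by rewrite -[t i]/(val (tF i)) -[t i.+1]/(val (tF i.+1)) -rmorphXn.
Qed.

Lemma short_top i n : tF i ^+ n < wF.
Proof. by have := tw i n; rewrite -[t i]/(val (tF i)) -[w]/(val wF) -rmorphXn. Qed.

Lemma tall_gens (g : seq tall) : (forall z, z \in g -> TK z) ->
  exists k, {subset g <= chain tK k.+1}.
Proof.
move=> gT; apply: (subset_bounded (P := fun z i => z \in (chain tK i.+1 : seq _))).
  move=> z i j le_ij; elim: j le_ij => [|j IH]; first by rewrite leqn0 => /eqP ->.
  rewrite leq_eqVlt => /orP[/eqP -> //|/IH zij] zi.
  by rewrite /= in_cons zij ?orbT.
by move=> z /gT [i ->]; exists i; apply: mem_chain.
Qed.

Lemma short_gens (g : seq short) : (forall z, z \in g -> TF z) ->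
  exists k, {subset g <= [tuple of wF :: chain tF k.+1]}.
Proof.
move=> gT; apply: (subset_bounded (P := fun z i => z \in ([tuple of wF :: chain tF i.+1] : seq _))).
  move=> z i j le_ij; elim: j le_ij => [|j IH]; first by rewrite leqn0 => /eqP ->.
  rewrite leq_eqVlt => /orP[/eqP -> //|/IH zij] /zij.
  by rewrite /= !in_cons => /orP[->|->]; rewrite ?orbT.
move=> z /gT [[|i] ->]; first by exists 0%N; rewrite mem_head.
by exists i; rewrite inE; apply/orP; right; apply: (@mem_chain _ tF).
Qed.

Lemma short_rapid k : rapid [tuple of wF :: chain tF k].
Proof.
apply/rapid_consE; split; first exact: rapid_chainP short_chain k.
apply: chain_above => [||n]; [exact: short_chain | by move=> i n _; exact: short_top |].
exact: le_lt_trans (ltW (chain_pow2 short_chain 0 n)) (short_top 0 1).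
Qed.

Lemma tall_short_isotypic : isotypic (ring_structure tall) (ring_structure short).
Proof.
split=> k.
  apply: (transfer_tp (fun x => rc_algebraic short x)) => [g /tall_gens [m gm]|m].
    by exists m.+1, (chain tK m.+1); split=> //; exact: rapid_chainP tall_chain _.
  by exists (chain tF m); exact: rapid_chainP short_chain _.
move=> b; have [||a ab] := transfer_tp (L := tall) (fun x => rc_algebraic tall x) _ _ b.
- move=> g /short_gens [m gm]; exists m.+2, [tuple of wF :: chain tF m.+1].
  by split=> //; exact: short_rapid.
- by move=> m; exists (chain tK m); exact: rapid_chainP tall_chain _.
by exists a.
Qed.

Lemma tall_bounded (x : tall) : exists k n, x <= tK k ^+ n.
Proof.
have [g [/tall_gens [k gk] h]] :=
  tp_algebraic_bounded (fun x => rc_algebraic tall x) (chain_tall tall_chain) x.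
exists k; apply: (h _ (chain tK k.+1)) => //.
- exact: rapid_chainP tall_chain _.
- exact: chain_ge2 tall_chain k.
by move=> i; apply: (chain_abs_le tall_chain); exact: mem_tnth.
Qed.

Lemma short_bounded (x : short) : exists n, x <= wF ^+ n.
Proof.
have [g [/short_gens [k gk] h]] :=
  tp_algebraic_bounded (fun x => rc_algebraic tall x) (chain_tall tall_chain) x.
have tF_le i : tF i <= wF by have := short_top i 1; rewrite expr1 => /ltW.
have w2 : 2 <= wF := le_trans (chain_ge2 short_chain 0) (tF_le 0).
apply: (h _ [tuple of wF :: chain tF k.+1]) => //; first exact: short_rapid.
move=> i; have := mem_tnth i [tuple of wF :: chain tF k.+1].
rewrite inE => /orP[/eqP ->|/(chain_abs_le short_chain) /le_trans -> //].
by rewrite ger0_norm // (le_trans _ w2).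
Qed.

(** In the tall field some element exceeds all powers of any given [x]; take [x]
    to be sent to the top generator, whose powers are cofinal in the short
    field. *)
Lemma tall_short_not_isomorphic : ~ ring_isomorphic tall short.
Proof.
case=> f [f' f'K fK']; pose x := f' wF.
have [k [n xk]] := tall_bounded `|x|.
have powx m : x ^+ m < tK k.+1.
  apply: le_lt_trans (chain_pow tall_chain (n * m) (ltnSn k)).
  by rewrite exprM (le_trans (ler_norm _)) // normrX lerXn2r ?nnegrE // (le_trans _ xk).
have [m wm] := short_bounded (f (tK k.+1)).
have := rmorph_rcf_le f (ltW (powx m.+1)); rewrite rmorphXn /= fK' => /le_trans /(_ wm).
have w1 : 1 < wF.
  by apply: lt_trans (short_top 0 1); have := chain_pow2 short_chain 0 0; rewrite !expr0 expr1.
by rewrite ler_eXn2l // ltnn.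
Qed.

End TwoClosures.

Theorem theorem4p1 :
  exists K F : countFieldType,
    isotypic (ring_structure K) (ring_structure F) /\ ~ ring_isomorphic K F.
Proof.
have [H [t [w [rt tw]]]] := exists_chain_and_bound.
exists (real_closure t), (real_closure (with_top t w)); split.
  exact: tall_short_isotypic.
exact: tall_short_not_isomorphic.
Qed.
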